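(* Under the standing assumptions stated in the context, the optimal control problem (P) admits at least one solution, i.e., there is a feasible control $u^*$ with associated state $x^*$ such that $J(x^*,u^* )\le J(x,u)$ for every feasible control $u$ with associated state $x$.
   Context: Let $n,m\ge1$, $T>0$, $\tau>0$, $I=[0,T]$, $I_\tau=[-\tau,T]$. For $x\in C(I_\tau;\mathbb{R}^n)$ and $t\in I$, $\max x_t:=\max_{s\in[t-\tau,t]}x(s)$ componentwise. Standing assumptions: $F(x,v,u)=F_0(x,v)+F_1(x,v)u$ with $F_0:\mathbb{R}^n\times\mathbb{R}^n\to\mathbb{R}^n$, $F_1:\mathbb{R}^n\times\mathbb{R}^n\to\mathbb{R}^{n\times m}$ globally Lipschitz continuous and continuously differentiable; $\phi\in C([-\tau,0];\mathbb{R}^n)$; $U\subset\mathbb{R}^m$ nonempty, convex and compact; $j:I\times\mathbb{R}^n\times\mathbb{R}^m\to\mathbb{R}$ a nonnegative normal integrand, convex in its third argument, differentiable in its second argument with derivative continuous in the second and third arguments. For $u\in L^\infty(I;\mathbb{R}^m)$ the associated state is the unique $x\in C(I_\tau;\mathbb{R}^n)\cap W^{1,\infty}(I;\mathbb{R}^n)$ with $x'(t)=F(x(t),\max x_t,u(t))$ for a.e. $t\in(0,T)$ and $x=\phi$ on $[-\tau,0]$. A control $u\in L^\infty(I;\mathbb{R}^m)$ is feasible if $u(t)\in U$ for a.e. $t\in I$. Problem (P): minimize $J(x,u)=\int_0^T j(t,x(t),u(t))\,\mathrm{d}t$ over feasible controls $u$ with associated states $x$. *)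

(* Defs.v *)
(* MathComp + MathComp-Analysis, over an abstract [R : realType].
   Vectors of R^n are column vectors 'cV[R]_n (normed with the max norm). *)
From mathcomp Require Import all_boot all_order all_algebra.
From mathcomp Require Import all_classical all_reals all_analysis.
Import Order.TTheory GRing.Theory Num.Theory.
Import numFieldNormedType.Exports.

Set Implicit Arguments.
Unset Strict Implicit.
Unset Printing Implicit Defensive.

Local Open Scope classical_set_scope.
Local Open Scope ring_scope.

(* The real line equipped with the Lebesgue (= completed, Caratheodory)
   sigma-algebra: the measurable type on which [completed_lebesgue_measure]
   lives.  Its carrier is (convertible to) R. *)
Definition LebT (R : realType) : Type :=
  caratheodory_type ((@wlength R idfun)^*)%mu.


(* Lebesgue measurable subsets of R. *)
Definition leb_measurable (R : realType) (A : set R) : Prop :=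
  @measurable _ (LebT R) (A : set (LebT R)).

(* Borel sigma-algebra of a topological space. *)
Definition borel_set (X : topologicalType) (B : set X) : Prop :=
  <<s [set O : set X | open O] >> B.

(* The product sigma-algebra  L(R) (x) B(Y)  on R * Y. *)
Definition leb_borel_set (R : realType) (Y : topologicalType)
    (C : set (R * Y)) : Prop :=
  <<s [set D : set (R * Y) | exists A B,
          [/\ leb_measurable A, borel_set B & D = A `*` B] ] >> C.

(* Normal integrand on I x (R^n x R^m), I = [0,T] (real-valued case).
   Since the Lebesgue sigma-algebra on I is complete, a (finite-valued)
   function is a normal integrand iff it is L(I)(x)B-measurable and
   lower semicontinuous in (x,u) for every t (Rockafellar--Wets,
   Def. 14.27 and Cor. 14.34). *)
Definition normal_integrand (R : realType) (n m : nat) (T : R)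
    (j : R -> 'cV[R]_n -> 'cV[R]_m -> R) : Prop :=
  (forall a : R,
     leb_borel_set ([set p : R * ('cV[R]_n * 'cV[R]_m) |
                       p.1 \in `[0, T] /\ j p.1 p.2.1 p.2.2 <= a])) /\
  (forall t, t \in `[0, T] ->
     lower_semicontinuous (fun p : 'cV[R]_n * 'cV[R]_m => (j t p.1 p.2)%:E)).

(* f : V -> W is continuously differentiable: differentiable everywhere with
   derivative depending continuously on the point (in finite dimension,
   equivalently: every directional derivative is continuous). *)
Definition C1 (R : realType) (V W : normedModType R) (f : V -> W) : Prop :=
  (forall p, differentiable f p) /\ (forall v : V, continuous (fun p => 'D_v f p)).

(* componentwise max over the delay window:  (max x_t)_i = max_{s in [t-tau,t]} x_i(s) *)
Definition maxd (R : realType) (n : nat) (tau : R) (x : R -> 'cV[R]_n) (t : R)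
  : 'cV[R]_n :=
  \col_i sup [set (x s) i 0 | s in [set` `[t - tau, t]]].

(* x is the state associated with the control u:
   x in C([-tau,T]; R^n) /\ W^{1,oo}(0,T; R^n), x = phi on [-tau,0], and
   x'(t) = F0(x(t), max x_t) + F1(x(t), max x_t) u(t) for a.e. t in (0,T).
   W^{1,oo}(I) is rendered as "Lipschitz on I", and its (weak) derivative as
   the classical derivative, which exists a.e. for such functions. *)
Definition assoc_state (R : realType) (n m : nat) (T tau : R)
    (F0 : 'cV[R]_n -> 'cV[R]_n -> 'cV[R]_n)
    (F1 : 'cV[R]_n -> 'cV[R]_n -> 'M[R]_(n, m))
    (phi : R -> 'cV[R]_n) (u : R -> 'cV[R]_m) (x : R -> 'cV[R]_n) : Prop :=
  [/\ {within [set` `[- tau, T]], continuous x},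
      (forall s, s \in `[- tau, 0] -> x s = phi s),
      [lipschitz x t | t in [set` `[0, T]]] &
      {ae (@lebesgue_measure R), forall t, t \in `]0, T[ ->
          derivable x t 1 /\
          'D_1 x t = F0 (x t) (maxd tau x t) + F1 (x t) (maxd tau x t) *m u t}].

(* u in L^oo(I; R^m): Lebesgue measurable on I and essentially bounded on I. *)
Definition Linfty (R : realType) (m : nat) (T : R) (u : R -> 'cV[R]_m) : Prop :=
  (forall i : 'I_m,
     measurable_fun ([set` `[0, T]] : set (LebT R)) (fun t : LebT R => u t i 0)) /\
  exists M : R, {ae (@lebesgue_measure R), forall t, t \in `[0, T] -> `|u t| <= M}.

(* feasible controls *)
Definition feasible (R : realType) (m : nat) (T : R) (U : set 'cV[R]_m)
    (u : R -> 'cV[R]_m) : Prop :=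
  Linfty T u /\ {ae (@lebesgue_measure R), forall t, t \in `[0, T] -> U (u t)}.

(* cost functional J(x,u) = int_0^T j(t,x(t),u(t)) dt  (in [0,+oo]) *)
Definition cost (R : realType) (n m : nat) (T : R)
    (j : R -> 'cV[R]_n -> 'cV[R]_m -> R)
    (x : R -> 'cV[R]_n) (u : R -> 'cV[R]_m) : \bar R :=
  (\int[@completed_lebesgue_measure R]_(t in ([set` `[0%R, T]] : set (LebT R)))
      (j t (x t) (u t))%:E)%E.

(* Main.v *)
Require Import Defs.
From mathcomp Require Import all_boot all_order all_algebra.
From mathcomp Require Import all_classical all_reals all_analysis.
From mathcomp Require Import measurable_realfun ring lra.
Import Order.TTheory GRing.Theory Num.Theory.
Import numFieldNormedType.Exports.
Local Open Scope classical_set_scope.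
Local Open Scope ring_scope.

(* Direct method.  After Borel modification of the controls, the states of a
   minimizing sequence are uniformly bounded and equi-Lipschitz (Gronwall,
   through an exponentially weighted norm), so a subsequence of states is
   uniformly close to some y.  In place of weak-* compactness of the controls,
   take iterated midpoints of the tails of the sequence of controls, with
   almost minimal L^2 norm: by the parallelogram law they are Cauchy in L^2 and
   a subsequence converges a.e. to some u with values in U.  The state equation
   is affine in the control, so along the uniformly converging states it
   survives averaging: y is the state of u.  Since U is compact and the
   x-derivative of j is continuous in (x, u), replacing the states by y costs an
   error that is small uniformly in the control; convexity of j in u bounds the
   cost at the averaged controls, and lower semicontinuity with Fatou's lemma
   bounds the cost of (y, u). *)

Set Implicit Arguments.
Unset Strict Implicit.
Unset Printing Implicit Defensive.

(** Since F is nonlinear in the state and in the delayed maximum, the state of an averaged control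
    is not the average of the states. Hence the limit [y] is fixed before any averaging: every
    control of the tail solves the equation of [y] up to a small defect, and this condition is
    stable under midpoints. Each running cost is likewise taken along the control's own state and
    averaged as a function of time, so that its integral is bounded by costs of the sequence without
    computing a new state. The comparison with [j t (y t)] takes place at one fixed [t]: the
    closeness it requires depends on [t], because [j] is merely measurable in time, but Fatou's
    lemma asks only for pointwise lower bounds. The Borel modification has a technical source: the
    cost integrates Lebesgue measurable controls against the completed measure, whereas the state
    equation is integrated against Lebesgue measure on the Borel sets. Costs are compared in the
    extended reals, so infinite values are allowed. *)

Section bounded_measurable.
Context {R : realType}.
Notation mu := (@lebesgue_measure R).
Implicit Types (f g : R -> R) (a b t M : R).

(** The bound holds everywhere and not just almost everywhere, so that sums, products and
    integrability on compact intervals are immediate. *)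
Definition bmeas f := measurable_fun setT f /\ exists M, forall s, `|f s| <= M.

Definition Int f t : R := \int[mu]_(s in `[0, t]) f s.

Lemma fine_mu_itv a b : a <= b -> fine (mu `[a, b]) = b - a.
Proof.
move=> ab; rewrite lebesgue_measure_itv/= lte_fin.
by move: ab; rewrite le_eqVlt => /predU1P[->|->//]; rewrite ltxx subrr.
Qed.

Lemma mu_itv_fin a b : (mu `[a, b] < +oo)%E.
Proof. by rewrite lebesgue_measure_itv/=; case: ifPn => _; rewrite ?ltry// -EFinD ltry. Qed.

Lemma bmeas_integrable f a b : bmeas f -> mu.-integrable `[a, b] (EFin \o f).
Proof.
move=> [mf [M fM]]; apply: measurable_bounded_integrable => //.
- exact: mu_itv_fin.
- exact: measurable_funTS.
- exists M; split; first exact: num_real.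
  by move=> M' MM' s _ /=; exact: (le_trans (fM s) (ltW MM')).
Qed.

Lemma bmeas_cst c : bmeas (fun=> c).
Proof. by split=> //; exists `|c|. Qed.

Lemma bmeasD f g : bmeas f -> bmeas g -> bmeas (fun s => f s + g s).
Proof.
move=> [mf [M fM]] [mg [N gN]]; split; first exact: measurable_funD.
by exists (M + N) => s; apply: (le_trans (ler_normD _ _)); exact: lerD.
Qed.

Lemma bmeasM f g : bmeas f -> bmeas g -> bmeas (fun s => f s * g s).
Proof.
move=> [mf [M fM]] [mg [N gN]]; split; first exact: measurable_funM.
by exists (M * N) => s; rewrite normrM; exact: ler_pM.
Qed.

Lemma bmeasZ c f : bmeas f -> bmeas (fun s => c * f s).
Proof. exact: (bmeasM (bmeas_cst c)). Qed.

Lemma bmeasB f g : bmeas f -> bmeas g -> bmeas (fun s => f s - g s).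
Proof.
move=> hf /(bmeasZ (-1)) hg; have := bmeasD hf hg.
by congr bmeas; apply/funext => s; rewrite mulN1r.
Qed.

Lemma bmeas_sum (I : Type) (r : seq I) (F : I -> R -> R) :
  (forall i, bmeas (F i)) -> bmeas (fun s => \sum_(i <- r) F i s).
Proof.
move=> hF; elim: r => [|i r IH].
  have := bmeas_cst 0; congr bmeas; apply/funext => s; by rewrite big_nil.
have := bmeasD (hF i) IH; congr bmeas; apply/funext => s.
by rewrite big_cons.
Qed.

Lemma IntD f g t : bmeas f -> bmeas g ->
  Int (fun s => f s + g s) t = Int f t + Int g t.
Proof. by move=> hf hg; rewrite /Int RintegralD//; exact: bmeas_integrable. Qed.

Lemma IntB f g t : bmeas f -> bmeas g ->
  Int (fun s => f s - g s) t = Int f t - Int g t.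
Proof. by move=> hf hg; rewrite /Int RintegralB//; exact: bmeas_integrable. Qed.

Lemma IntZ c f t : bmeas f -> Int (fun s => c * f s) t = c * Int f t.
Proof. by move=> hf; rewrite /Int RintegralZl//; exact: bmeas_integrable. Qed.

Lemma le_Int f g t : bmeas f -> bmeas g ->
  (forall s, 0 <= s <= t -> f s <= g s) -> Int f t <= Int g t.
Proof.
move=> hf hg fg; by apply: le_Rintegral => //; exact: bmeas_integrable.
Qed.

Lemma Int_cst c t : 0 <= t -> Int (fun=> c) t = c * t.
Proof. by move=> t0; rewrite /Int Rintegral_cst// fine_mu_itv// subr0. Qed.

Lemma le_normr_Int f g t : bmeas f -> bmeas g ->
  (forall s, 0 <= s <= t -> `|f s| <= g s) -> `|Int f t| <= Int g t.
Proof.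
move=> hf hg fg; rewrite ler_norml; apply/andP; split.
  rewrite -mulN1r -IntZ//; apply: le_Int => //; first exact: bmeasZ.
  by move=> s /fg; rewrite ler_norml mulN1r => /andP[].
by apply: le_Int => // s /fg; rewrite ler_norml => /andP[].
Qed.

Lemma Int_bound f M t : bmeas f -> 0 <= t ->
  (forall s, 0 <= s <= t -> `|f s| <= M) -> `|Int f t| <= M * t.
Proof.
move=> hf t0 fM; rewrite -Int_cst//.
by apply: le_normr_Int => //; exact: bmeas_cst.
Qed.

Lemma Int_lip f M s t : bmeas f -> (forall s, `|f s| <= M) ->
  0 <= s -> 0 <= t -> `|Int f t - Int f s| <= M * `|t - s|.
Proof.
move=> hf fM; wlog st : s t / s <= t => [wlg s0 t0|s0 t0].
  by have [/wlg->//|/ltW/wlg] := leP s t; rewrite distrC (distrC t); exact.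
rewrite /Int Rintegral_itvB ?bnd_simp//; last exact: bmeas_integrable.
have if_ : mu.-integrable `]s, t] (EFin \o f).
  apply: integrableS (bmeas_integrable s t hf) => //.
  by apply: subset_itvr; rewrite bnd_simp.
rewrite Rintegral_itv_obnd_cbnd// (ger0_norm (x := t - s)) ?subr_ge0//.
apply: le_trans (le_normr_Rintegral _ _) _ => //; first exact: bmeas_integrable.
rewrite -(fine_mu_itv st) -Rintegral_cst//.
have habs : bmeas (fun x => `|f x|).
  case: hf => mf _; split; first exact: measurableT_comp.
  by exists M => x; rewrite normr_id.
apply: le_Rintegral => //; first exact: bmeas_integrable.
exact: (bmeas_integrable _ _ (bmeas_cst M)).
Qed.

Lemma Int0 f : bmeas f -> Int f 0 = 0.
Proof.
move=> hf; have [_ [M fM]] := hf.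
have /(_ _ (lexx _)) := Int_bound (M := M) hf; rewrite mulr0 normr_le0 => h.
by apply/eqP/h => s _.
Qed.

Lemma ae_imp (P Q : R -> Prop) : (forall s, P s -> Q s) ->
  {ae mu, forall s, P s} -> {ae mu, forall s, Q s}.
Proof.
move=> PQ [N [mN N0 PN]]; exists N; split=> // s /= Qs.
by apply: PN => /= /PQ.
Qed.

Lemma ae_and (P Q : R -> Prop) : {ae mu, forall s, P s} ->
  {ae mu, forall s, Q s} -> {ae mu, forall s, P s /\ Q s}.
Proof.
move=> aP aQ; rewrite /almost_everywhere/= in aP aQ *.
have := negligibleU aP aQ; apply: negligibleS => s /= /not_andP.
by case; [left|right].
Qed.

Lemma ae_forall (P : nat -> R -> Prop) : (forall k, {ae mu, forall s, P k s}) ->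
  {ae mu, forall s, forall k, P k s}.
Proof.
move=> aP; have := negligible_bigcup aP; apply: negligibleS => s /=.
by move=> /existsNP[k Pk]; exists k.
Qed.

Lemma ae_forall_ord m (P : 'I_m -> R -> Prop) : (forall l, {ae mu, forall s, P l s}) ->
  {ae mu, forall s, forall l, P l s}.
Proof.
move=> aP; apply: (@ae_imp (fun s => forall k (l : 'I_m), l = k :> nat -> P l s)).
  by move=> s h l; exact: h.
apply: (@ae_forall (fun k s => forall l : 'I_m, l = k :> nat -> P l s)) => k.
have [km|mk] := ltnP k m.
  apply: ae_imp (aP (Ordinal km)) => s Ps l lk.
  by rewrite (_ : l = Ordinal km)//; exact: val_inj.
by apply: aeW => s l lk; have := ltn_ord l; rewrite lk ltnNge mk.
Qed.

Lemma ae_neq (c : R) : {ae mu, forall s, s != c}.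
Proof.
exists [set c]; split; [exact: measurable_set1|exact: lebesgue_measure_set1|].
by move=> s /= /negP; rewrite negbK => /eqP.
Qed.

Lemma Int_dominated (f_ : nat -> R -> R) f M t : 
  (forall k, bmeas (f_ k)) -> bmeas f -> (forall k s, `|f_ k s| <= M) ->
  {ae mu, forall s, 0 <= s <= t -> f_ k s @[k --> \oo] --> f s} ->
  Int (f_ k) t @[k --> \oo] --> Int f t.
Proof.
move=> hf_ hf f_M f_f.
have [| | | | | |_ _ h] := @dominated_convergence _ _ R mu `[0, t] _
   (fun k => EFin \o f_ k) (EFin \o f) (EFin \o cst M).
- exact: measurable_itv.
- by move=> k; apply/measurable_EFinP/measurable_funTS; case: (hf_ k).
- by apply/measurable_EFinP/measurable_funTS; case: hf.
- apply: ae_imp f_f => s f_f; rewrite /= in_itv/= => /f_f h.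
  by apply: cvg_EFin => //; exact: nearW.
- exact: (bmeas_integrable _ _ (bmeas_cst M)).
- by apply: aeW => s k _; rewrite /= lee_fin.
apply: fine_cvg; rewrite fineK//.
exact: integrable_fin_num (bmeas_integrable _ _ hf).
Qed.

(** * Differentiation of primitives and recovery of Lipschitz functions *)

Lemma Int_FTC f : bmeas f ->
  {ae mu, forall t, 0 < t -> derivable (Int f) t 1 /\ 'D_1 (Int f) t = f t}.
Proof.
move=> hf; have lf : locally_integrable setT f.
  split => //; [by case: hf|exact: openT|].
  move=> K _ cK; have [B [Br KB]] := compact_bounded cK.
  have KI : K `<=` `[- (B + 1), B + 1].
    move=> x Kx; rewrite /= in_itv/= -ler_norml; apply: KB => //.
    by rewrite ltrDl.
  have mK := compact_measurable cK.
  have : mu.-integrable K (EFin \o f).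
    by apply: integrableS (bmeas_integrable (- (B + 1)) (B + 1) hf).
  by move/integrableP => [].
have h := @FTC1 R f (BLeft 0) (fun y => bmeas_integrable 0 y hf) lf.
apply: ae_imp h => t /= h t0.
have := h _; rewrite lte_fin => /(_ t0); rewrite derive1E; exact.
Qed.

Lemma derivable_dquot_cvg (g : R -> R) s : derivable g s 1 ->
  k.+1%:R * (g (s + k.+1%:R^-1) - g s) @[k --> \oo] --> 'D_1 g s.
Proof.
move=> dg.
have h0 : k.+1%:R^-1 @[k --> \oo] --> (0 : R)^'.
  move=> A hA; have := @cvg_harmonic R _ hA.
  rewrite !nbhs_simpl/=; apply: filterS => k /=; apply.
  by apply: invr_neq0; rewrite pnatr_eq0.
have := cvg_comp _ _ h0 dg.
apply: cvg_trans; apply: near_eq_cvg; apply: nearW => k /=.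
by rewrite invrK [_%:A]mulr1 [in X in _ = _ * (g X - _)]addrC.
Qed.

Lemma lip_continuous (V W : normedModType R) (Y : V -> W) L :
  (forall s r, `|Y s - Y r| <= L * `|s - r|) -> continuous Y.
Proof.
move=> YL s; apply/cvgrPdist_le => e e0; near=> r.
have L1 : 0 < `|L| + 1 by rewrite ltr_wpDl.
apply: (le_trans (YL s r)); apply: (@le_trans _ _ ((`|L| + 1) * `|s - r|)).
  by rewrite ler_wpM2r// (le_trans (ler_norm L))// lerDl.
rewrite mulrC -ler_pdivlMr//; near: r; apply: cvgr_dist_le; first exact: cvg_id.
by rewrite divr_gt0.
Unshelve. all: by end_near. Qed.

(** The integrals of the difference quotients [Z k] of [Y] have two limits. The quotients are
    bounded by [L] and tend to [f] almost everywhere, which gives [Int f t]. Each is also the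
    derivative of the difference quotient [Q k] of a primitive [P] of [Y], and [Q k] tends to [Y]
    because [Y] is continuous. *)
Lemma lipschitz_FTC2 (Y f : R -> R) T L B : (forall s r, `|Y s - Y r| <= L * `|s - r|) ->
  (forall s, `|Y s| <= B) -> bmeas f ->
  {ae mu, forall t, 0 < t < T -> derivable Y t 1 /\ 'D_1 Y t = f t} ->
  forall t, 0 <= t <= T -> Y t - Y 0 = Int f t.
Proof.
move=> YL YB hf Yf t /andP[t0 tT].
have L0 : 0 <= L.
  have := YL 1 0; rewrite subr0 normr1 mulr1; exact: le_trans.
have cY : continuous Y := lip_continuous YL.
have bY : bmeas Y by split; [exact: continuous_measurable_fun|exists B].
have [t0'|] := ltP 0 t; last first.
  move=> tle0; have -> : t = 0 by lra.
  by rewrite subrr Int0.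
(* The base point -1 makes 0 interior, so that [P] has a two-sided derivative there. *)
pose P (s : R) : R := \int[mu]_(r in `[- 1, s]) Y r.
have dP s : - 1 < s -> derivable P s 1 /\ 'D_1 P s = Y s.
  move=> s1; have [| | | |? <-] := @continuous_FTC1 R Y (BLeft (- 1)) s (s + 1).
  - by rewrite ltrDl.
  - exact: bmeas_integrable.
  - by rewrite /= lte_fin.
  - exact: cY.
  - by rewrite derive1E.
move: P dP => P dP.
pose h k : R := k.+1%:R^-1.
have h0 k : 0 < h k by rewrite invr_gt0.
pose Z k s := k.+1%:R * (Y (s + h k) - Y s).
pose Q k s := k.+1%:R * (P (s + h k) - P s).
have dQ k (s : R) : - 1 < s -> is_derive s (1 : R) (Q k) (Z k s).
  move=> s1.
  have [d1 e1] := dP _ s1.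
  have s1h : - 1 < s + h k by rewrite ltr_wpDr// ltW.
  have [d2 e2] := dP _ s1h.
  have D1 : is_derive s (1 : R) P (Y s) := DeriveDef d1 e1.
  have D2 : is_derive (s + h k) (1 : R) P (Y (s + h k)) := DeriveDef d2 e2.
  have D3 : is_derive s (1 : R) (fun s : R => s + h k) (1 + 0).
    by apply: is_deriveD.
  have D4 := @is_derive1_comp R P (fun s => s + h k) s _ _ D2 D3.
  have := is_deriveZ k.+1%:R (is_deriveB D4 D1).
  by rewrite /Q /Z /GRing.scale/= addr0 mulr1.
have bYs k : bmeas (fun s => Y (s + h k)).
  split; last by exists B.
  apply: measurableT_comp; first by case: bY.
  exact: measurable_funD.
have bZ k : bmeas (Z k) by apply: bmeasZ; exact: bmeasB.
have cZ k : continuous (Z k).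
  move=> s; apply: cvgM; first exact: cvg_cst.
  apply: cvgB; last exact: cY.
  apply: (@cvg_comp _ _ _ (fun s => s + h k) Y _ (nbhs (s + h k))); last exact: cY.
  by apply: cvgD; [exact: cvg_id|exact: cvg_cst].
have IZ k : Int (Z k) t = Q k t - Q k 0.
  have cQ s : - 1 < s -> {for s, continuous (Q k)}.
    move=> /(dQ k) d; apply: differentiable_continuous.
    by apply/derivable1_diffP; case: d.
  rewrite /Int /Rintegral (@continuous_FTC2 _ (Z k) (Q k))//.
  - exact: continuous_subspaceT.
  - split.
    + move=> s; rewrite in_itv/= => /andP[s0 _].
      by have [] : is_derive s (1 : R) (Q k) (Z k s) by apply: dQ; lra.
    + by apply: cvg_at_right_filter; apply: cQ; lra.
    + by apply: cvg_at_left_filter; apply: cQ; lra.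
  - move=> s; rewrite in_itv/= => /andP[s0 _].
    have [_ <-] : is_derive s (1 : R) (Q k) (Z k s) by apply: dQ; lra.
    by rewrite derive1E.
have lim1 : Int (Z k) t @[k --> \oo] --> Y t - Y 0.
  under eq_fun do rewrite IZ.
  have [d1 <-] : derivable P t 1 /\ 'D_1 P t = Y t by apply: dP; lra.
  have [d2 <-] : derivable P 0 1 /\ 'D_1 P 0 = Y 0 by apply: dP; lra.
  by apply: cvgB; exact: derivable_dquot_cvg.
have lim2 : Int (Z k) t @[k --> \oo] --> Int f t.
  apply: (@Int_dominated _ _ L) => //.
  - move=> k s; rewrite /Z normrM ger0_norm// mulrC -ler_pdivlMr//.
    apply: (le_trans (YL _ _)); rewrite addrAC subrr add0r ger0_norm//.
    exact: ltW.
  (* The equation is known on the open interval only; the end points 0 and [t] are discarded as null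
     sets. *)
  - have := ae_and Yf (ae_and (ae_neq 0) (ae_neq t)).
    apply: ae_imp => s [{}Yf [s0 st]] /andP[s0' st'].
    have [|d <-] := Yf; last exact: derivable_dquot_cvg.
    by rewrite lt_neqAle eq_sym s0 s0' /= (lt_le_trans _ tT)// lt_neqAle st.
exact: (cvg_unique _ lim1 lim2).
Qed.

(** * Truncation to an interval and the exponential weight *)

Definition clamp a b s : R := Order.max a (Order.min b s).

Lemma clamp_itv a b s : a <= b -> a <= clamp a b s <= b.
Proof. by move=> ab; rewrite /clamp; apply/andP; split; rewrite ?le_max ?lexx// ge_max ab ge_min lexx. Qed.

Lemma clamp_id a b s : a <= s <= b -> clamp a b s = s.
Proof. by move=> /andP[as_ sb]; rewrite /clamp (min_idPr sb) (max_idPr as_). Qed.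

Lemma clamp_le a b s r : s <= r -> clamp a b s <= clamp a b r.
Proof.
move=> sr; rewrite /clamp /Order.max /Order.min.
by case: (ltP b s) => ?; case: (ltP b r) => ?; case: (ltP a b) => ?;
  case: (ltP a s) => ?; case: (ltP a r) => ?; lra.
Qed.

Lemma clamp_lip a b s r : `|clamp a b s - clamp a b r| <= `|s - r|.
Proof.
wlog sr : s r / r <= s => [wlg|].
  by have [/wlg//|/ltW/wlg] := leP r s; rewrite distrC (distrC r).
rewrite !ger0_norm ?subr_ge0 ?clamp_le//.
rewrite /clamp /Order.max /Order.min.
by case: (ltP b s) => ?; case: (ltP b r) => ?; case: (ltP a b) => ?;
  case: (ltP a s) => ?; case: (ltP a r) => ?; lra.
Qed.

Lemma clamp_continuous a b : continuous (clamp a b).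
Proof.
apply: (@lip_continuous R R _ 1) => s r; rewrite mul1r; exact: clamp_lip.
Qed.

(** The truncation keeps the exponential bounded on the line and equal to 1 on the history. For
    [l >= 0] it is nondecreasing, so a bound by a multiple of the weight at one time covers all
    earlier times, in particular the delay window. *)
Definition weight l T s := expR (l * clamp 0 T s).

Lemma weight_gt0 l T s : 0 < weight l T s.
Proof. exact: expR_gt0. Qed.

Lemma weight_le l T s r : 0 <= l -> s <= r -> weight l T s <= weight l T r.
Proof. by move=> l0 sr; rewrite ler_expR ler_wpM2l// clamp_le. Qed.

Lemma weight_bound l T s : 0 <= l -> 0 <= T -> weight l T s <= expR (l * T).
Proof. by move=> l0 T0; rewrite ler_expR ler_wpM2l//; case/andP: (clamp_itv s T0). Qed.

Lemma weight_ge1 l T s : 0 <= l -> 0 <= T -> 1 <= weight l T s.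
Proof.
move=> l0 T0; rewrite -expR0 ler_expR mulr_ge0//.
by case/andP: (clamp_itv s T0).
Qed.

Lemma weight_continuous l T : continuous (weight l T).
Proof.
move=> s; apply: continuous_comp; last exact: continuous_expR.
by apply: cvgM; [exact: cvg_cst|exact: clamp_continuous].
Qed.

Lemma bmeas_weight l T : 0 <= l -> 0 <= T -> bmeas (weight l T).
Proof.
move=> l0 T0; split.
  by apply: continuous_measurable_fun; exact: weight_continuous.
by exists (expR (l * T)) => s; rewrite gtr0_norm ?weight_gt0// weight_bound.
Qed.

(* The weight makes [Int] a contraction by the factor [l^-1] (Bielecki). *)
Lemma Int_weight l T t : 0 < l -> 0 <= t <= T -> Int (weight l T) t <= l^-1 * weight l T t.
Proof.
move=> l0 /andP[t0 tT].
have T0 := le_trans t0 tT.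
move: (t0); rewrite le_eqVlt => /predU1P[<-|t0'].
  rewrite Int0; last by apply: bmeas_weight => //; exact: ltW.
  by rewrite mulr_ge0 ?invr_ge0 ?ltW// weight_gt0.
have wE s : 0 <= s <= t -> weight l T s = expR (l * s).
  by move=> /andP[s0 st]; rewrite /weight clamp_id// s0 (le_trans st).
pose F s : R := l^-1 * expR (l * s).
have dF (s : R) : is_derive s (1 : R) F (expR (l * s)).
  have D1 : is_derive s (1 : R) (fun s : R => l * s) (l * 1) by apply: is_deriveZ.
  have := is_deriveZ l^-1 (is_derive1_comp (is_derive_expR (l * s)) D1).
  by rewrite /GRing.scale/= mulr1 mulrCA mulVf ?gt_eqF// mulr1.
rewrite (wE t) ?t0 ?lexx// /Int /Rintegral.
have cF s : {for s, continuous F}.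
  apply: differentiable_continuous; apply/derivable1_diffP.
  by case: (dF s).
rewrite (@continuous_FTC2 _ (weight l T) F)//=.
- by rewrite lerBlDr lerDl mulr_ge0 ?invr_ge0 ?ltW// expR_gt0.
- by apply: continuous_subspaceT; exact: weight_continuous.
- split.
  + by move=> s _; case: (dF s).
  + by apply: cvg_at_right_filter; exact: cF.
  + by apply: cvg_at_left_filter; exact: cF.
- move=> s; rewrite in_itv/= => /andP[s0 st].
  by rewrite derive1E; have [_ ->] := dF s; rewrite wE// !ltW.
Qed.

End bounded_measurable.

Section matrix_norm.
Context {R : realType}.

Lemma entry_le_norm m n (A : 'M[R]_(m, n)) i j : `|A i j| <= `|A|.
Proof.
by rewrite [leRHS]/Num.norm /= mx_normrE; exact: (le_bigmax _ (fun ij => `|A ij.1 ij.2|) (i, j)).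
Qed.

Lemma norm_le_entry m n (A : 'M[R]_(m, n)) e :
  0 <= e -> (forall i j, `|A i j| <= e) -> `|A| <= e.
Proof.
by move=> e0 Ae; rewrite [leLHS]/Num.norm /= mx_normrE; apply: bigmax_le => // -[].
Qed.

Lemma colv_le_norm n (A : 'cV[R]_n) e :
  0 <= e -> (forall i, `|A i 0| <= e) -> `|A| <= e.
Proof. by move=> e0 Ae; apply: norm_le_entry => // i j; rewrite ord1. Qed.

Lemma mulmx_norm_le n m (A : 'M[R]_(n, m)) (w : 'cV[R]_m) :
  `|A *m w| <= m%:R * (`|A| * `|w|).
Proof.
apply: colv_le_norm => [|i]; first by rewrite !mulr_ge0.
rewrite mxE (le_trans (ler_norm_sum _ _ _))//.
have -> : m%:R = \sum_(k < m) (1 : R) by rewrite sumr_const card_ord.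
rewrite mulr_suml; apply: ler_sum => k _; rewrite mul1r normrM.
by apply: ler_pM => //; exact: entry_le_norm.
Qed.

Lemma colv_cvg n (x : nat -> 'cV[R]_n) (y : 'cV[R]_n) :
  (forall i, x k i 0 @[k --> \oo] --> y i 0) -> x k @[k --> \oo] --> y.
Proof.
move=> xy; apply/cvgrPdist_le => e e0.
have : \forall k \near \oo, forall i, `|y i 0 - x k i 0| <= e.
  apply: filter_forall => i.
  by have /cvgrPdist_le := xy i; exact.
apply: filterS => k h; apply: colv_le_norm => [|i]; first exact: ltW.
by rewrite !mxE.
Qed.

Lemma cvg_colv n (x : nat -> 'cV[R]_n) (y : 'cV[R]_n) i :
  x k @[k --> \oo] --> y -> x k i 0 @[k --> \oo] --> y i 0.
Proof.
move=> xy; apply/cvgrPdist_le => e e0.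
move/cvgrPdist_le : xy => /(_ e e0); apply: filterS => k.
by apply: le_trans; apply: le_trans (entry_le_norm _ i 0); rewrite !mxE.
Qed.

End matrix_norm.

(** * Continuous trajectories and their delayed maximum *)

Section trajectories.
Context {R : realType} {n : nat}.
Implicit Types (x y : R -> 'cV[R]_n) (a b e t s : R).

(* A function on [a, b] is encoded by its extension to R by constants. *)
Definition traj a b x := continuous x /\ forall s, x s = x (clamp a b s).

Lemma traj_bounded a b x : a <= b -> traj a b x -> exists B, forall s, `|x s| <= B.
Proof.
move=> ab [cx xE].
have [|c cab hc] := @EVT_max R (fun s => `|x s|) a b ab.
  by apply: continuous_subspaceT => s; apply: continuous_comp (cx s) _; exact: norm_continuous.
exists `|x c| => s; rewrite xE; apply: hc.
by rewrite in_itv/= clamp_itv.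
Qed.

(** Heine-Cantor: compactness of [a, b] is used with the radius [d] as a parameter tending to 0,
    which makes the local radii uniform. As [clamp] is 1-Lipschitz, the modulus found on [a, b]
    serves on the whole line. *)
Lemma traj_unif a b x : a <= b -> traj a b x -> forall e, 0 < e ->
  exists2 d, 0 < d & forall r s, `|r - s| < d -> `|x r - x s| <= e.
Proof.
move=> ab [cx xE] e e0.
have /compact_near_coveringP/(_ R (0^'+) (fun d r => forall s, `|r - s| < d -> `|x r - x s| <= e) _) := @segment_compact R a b.
case.
  move=> r _.
  have e2 : 0 < e / 2 by rewrite divr_gt0.
  have /cvgrPdist_lt/(_ _ e2)[d /= d0 hd] := cx r.
  have d2 : 0 < d / 2 by rewrite divr_gt0.
  exists (ball r (d / 2), [set d' | 0 < d' < d / 2]) => /=.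
    split; first exact: nbhsx_ballx.
    near=> d'; apply/andP; split => //.
  move=> [r' d'] /= [rr' /andP[d'0 d'd]] s r's.
  have h1 : `|x r - x r'| < e / 2 by apply: hd => /=; rewrite (lt_le_trans rr')// ler_pdivrMr// ler_peMr ?ler1n// ltW.
  have h2 : `|x r - x s| < e / 2.
    apply: hd => /=; rewrite (splitr d) -(subrKA r') (le_lt_trans (ler_normD _ _))//.
    by rewrite ltrD// (lt_trans r's).
  rewrite -(subrKA (x r)) (splitr e) (le_trans (ler_normD _ _))// lerD//.
    by rewrite distrC ltW.
  exact: ltW.
move=> d0 /= d00 hd; exists (d0 / 2); first by rewrite divr_gt0.
move=> r s rs; rewrite (xE r) (xE s).
have := hd (d0 / 2); apply.
- rewrite /= sub0r normrN ger0_norm ?divr_ge0// ?ltW//.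
  by rewrite gtr_pMr// invf_lt1// ltr1n.
- by rewrite divr_gt0.
- by rewrite /= in_itv/= clamp_itv.
- exact: le_lt_trans (clamp_lip _ _ _ _) rs.
Unshelve. all: by end_near.
Qed.

(** The partner [r'] will be the same point when two functions are compared at one time, and a
    translated point when one function is compared at two times. The bound on [y] makes the
    right-hand supremum a genuine one. *)
Lemma maxd_le x y tau t s i e B : 0 <= tau -> (forall r, `|y r| <= B) ->
  (forall r, t - tau <= r <= t -> exists2 r', s - tau <= r' <= s & x r i 0 <= y r' i 0 + e) ->
  maxd tau x t i 0 <= maxd tau y s i 0 + e.
Proof.
move=> tau0 yB xy; rewrite /maxd !mxE; apply: ge_sup.
  by exists (x t i 0); exists t => //=; rewrite in_itv/= lexx gerBl tau0.
move=> z [r /=]; rewrite in_itv/= => /xy[r' r's xr] <-.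
apply: (le_trans xr); rewrite lerD2r; apply: ub_le_sup.
  exists B => _ [p _ <-]; apply: le_trans (yB p); apply: le_trans (entry_le_norm _ i 0).
  exact: ler_norm.
by exists r' => //=; rewrite in_itv.
Qed.

(** Closeness is asked on the whole past of [t], the form in which the weighted estimates supply
    it. *)
Lemma maxd_dist x y tau t e B C : 0 <= tau -> (forall r, `|x r| <= B) -> (forall r, `|y r| <= C) ->
  (forall r, r <= t -> `|x r - y r| <= e) -> `|maxd tau x t - maxd tau y t| <= e.
Proof.
move=> tau0 xB yC xy.
have e0 : 0 <= e by apply: le_trans (xy t (lexx _)).
apply: colv_le_norm => // i; rewrite mxE [X in _ + X]mxE ler_distl; apply/andP; split.
  rewrite lerBlDr; apply: maxd_le xB _ => // r /andP[r1 r2].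
  exists r; first exact/andP.
  rewrite -lerBlDl; apply: (le_trans (ler_norm _)); rewrite distrC.
  by apply: le_trans (xy r r2); apply: le_trans (entry_le_norm _ i 0); rewrite !mxE.
apply: maxd_le yC _ => // r /andP[r1 r2].
exists r; first exact/andP.
rewrite -lerBlDl; apply: (le_trans (ler_norm _)).
by apply: le_trans (xy r r2); apply: le_trans (entry_le_norm _ i 0); rewrite !mxE.
Qed.

Lemma maxd_norm x tau t e B : 0 <= tau -> (forall r, `|x r| <= B) ->
  (forall r, r <= t -> `|x r| <= e) -> `|maxd tau x t| <= e.
Proof.
move=> tau0 xB xe.
have := @maxd_dist x (fun=> 0) tau t e B 0 tau0 xB.
have -> : maxd tau (fun=> 0 : 'cV[R]_n) t = 0.
  apply/matrixP => i j; rewrite /maxd !mxE (_ : [set _ | _ in _] = [set 0]) ?sup1//.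
  apply/seteqP; split=> [_ [r _ <-]|_ ->]/=; first by [].
  by exists t => //=; rewrite ?mxE//= in_itv/= lexx gerBl tau0.
rewrite subr0; apply => // r; first by rewrite normr0.
by rewrite subr0; exact: xe.
Qed.

Lemma maxd_continuous a b x tau : a <= b -> 0 <= tau -> traj a b x -> continuous (maxd tau x).
Proof.
move=> ab tau0 tx t; have [B xB] := traj_bounded ab tx.
apply/cvgrPdist_le => e e0.
have [d d0 hd] := traj_unif ab tx e0.
near=> s.
have ts : `|t - s| < d by near: s; apply: cvgr_dist_lt => //; exact: cvg_id.
have key p q i : `|p - q| < d -> maxd tau x p i 0 <= maxd tau x q i 0 + e.
  move=> pq; apply: maxd_le xB _ => // r /andP[r1 r2].
  (* The windows at [p] and [q] are translates of each other. *)
  exists (r - p + q); first by apply/andP; split; lra.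
  rewrite -lerBlDl; apply: (le_trans (ler_norm _)).
  have := hd r (r - p + q); rewrite opprD addrA opprB addrCA subrr addr0 => /(_ pq).
  by apply: le_trans; apply: le_trans (entry_le_norm _ i 0); rewrite !mxE.
apply: colv_le_norm => [|i]; first exact: ltW.
by rewrite mxE [X in _ + X]mxE ler_distl lerBlDr !key// distrC.
Unshelve. all: by end_near.
Qed.

End trajectories.

(** * Estimates of the right-hand side for bounded controls *)

Section right_hand_side.
Context {R : realType} {n m : nat} (tau : R)
  (F0 : 'cV[R]_n -> 'cV[R]_n -> 'cV[R]_n)
  (F1 : 'cV[R]_n -> 'cV[R]_n -> 'M[R]_(n, m)) (U : set 'cV[R]_m).
Implicit Types (x y : R -> 'cV[R]_n) (u v w : 'cV[R]_m).

Definition rhs x s w := F0 (x s) (maxd tau x s) + F1 (x s) (maxd tau x s) *m w.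

(** The Lipschitz condition for the maximum norm of the product, with one bound for both arguments:
    a trajectory and its delayed maximum are estimated by the same [e]. *)
Definition lip2 p q (F : 'cV[R]_n -> 'cV[R]_n -> 'M[R]_(p, q)) L :=
  forall a b a' b' e, `|a - a'| <= e -> `|b - b'| <= e -> `|F a b - F a' b'| <= L * e.

Lemma lipschitz_lip2 p q (F : 'cV[R]_n -> 'cV[R]_n -> 'M[R]_(p, q)) :
  lipschitz (fun ab : 'cV[R]_n * 'cV[R]_n => F ab.1 ab.2) ->
  exists2 L, 0 <= L & lip2 F L.
Proof.
move=> lF; near (pinfty_nbhs R) => L.
have L0 : 0 <= L by near: L; exact: nbhs_pinfty_ge.
exists L => // a b a' b' e ae be.
have : L.-lipschitz_setT (fun ab : 'cV[R]_n * 'cV[R]_n => F ab.1 ab.2) by near: L.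
move=> /(_ ((a, b), (a', b')))/= /(_ _)/le_trans; apply => //.
by rewrite ler_wpM2l// /Num.norm/= ge_max ae be.
Unshelve. all: by end_near.
Qed.

Context (L M : R) (L0 : 0 <= L) (F0L : lip2 F0 L) (F1L : lip2 F1 L)
  (UM : forall w, U w -> `|w| <= M) (tau0 : 0 <= tau).

(** Lipschitz constant of [rhs] in the trajectory, for controls of norm at most [M]; the factor [m]
    is the loss of the maximum norm in a matrix-vector product. The next constant bounds [rhs] along
    the zero trajectory. *)
Definition lip_const : R := L + m%:R * (L * M).
Definition growth_const : R := `|F0 0 0| + m%:R * (`|F1 0 0| * M).

Lemma field_dist x y s w e B C : (forall r, `|x r| <= B) -> (forall r, `|y r| <= C) ->
  (forall r, r <= s -> `|x r - y r| <= e) -> U w ->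
  `|rhs x s w - rhs y s w| <= lip_const * e.
Proof.
move=> xB yC xy Uw; rewrite /rhs opprD addrACA -mulmxBl.
have xys := xy s (lexx _); have mxy := maxd_dist tau0 xB yC xy.
have e0 : 0 <= e by apply: le_trans xys.
rewrite (le_trans (ler_normD _ _))// mulrDl lerD//; first exact: F0L.
rewrite (le_trans (mulmx_norm_le _ _))// -mulrA ler_wpM2l// mulrAC.
by apply: ler_pM => //; [exact: F1L|exact: UM].
Qed.

Lemma field_bound x s w e B : (forall r, `|x r| <= B) ->
  (forall r, r <= s -> `|x r| <= e) -> U w -> `|rhs x s w| <= growth_const + lip_const * e.
Proof.
move=> xB xe Uw.
have mx := maxd_norm tau0 xB xe; have xs := xe s (lexx _).
have e0 : 0 <= e by apply: le_trans xs.
have M0 : 0 <= M by apply: le_trans (UM Uw).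
have bnd p q (F : 'cV[R]_n -> 'cV[R]_n -> 'M[R]_(p, q)) : lip2 F L ->
    `|F (x s) (maxd tau x s)| <= `|F 0 0| + L * e.
  move=> FL; rewrite -[F _ _](subrKC (F 0 0)) (le_trans (ler_normD _ _))// lerD2l.
  by apply: FL; rewrite subr0.
rewrite /rhs (le_trans (ler_normD _ _))//.
apply: (@le_trans _ _ ((`|F0 0 0| + L * e) + m%:R * ((`|F1 0 0| + L * e) * M))).
  apply: lerD; first exact: bnd.
  rewrite (le_trans (mulmx_norm_le _ _))// ler_wpM2l//.
  by apply: ler_pM => //; [exact: bnd|exact: UM].
by rewrite le_eqVlt; apply/orP; left; apply/eqP; rewrite /growth_const /lip_const; ring.
Qed.

Lemma field_midpoint x s v w :
  rhs x s (2^-1 *: (v + w)) = 2^-1 *: (rhs x s v + rhs x s w).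
Proof.
rewrite /rhs -scalemxAr mulmxDr addrACA [RHS]scalerDr; congr (_ + _).
by rewrite scalerDr -scalerDl -[2^-1]mul1r -splitr scale1r.
Qed.

(** Borel measurability and membership in [U] are asked on the whole line, so that integrands built
    from a control lie in [bmeas] with no exceptional set. *)
Definition ctrl (u : R -> 'cV[R]_m) :=
  (forall l, measurable_fun setT (fun s => u s l 0)) /\ forall s, U (u s).

Lemma field_bmeas a b x (u : R -> 'cV[R]_m) i : a <= b -> traj a b x -> ctrl u ->
  bmeas (fun s => rhs x s (u s) i 0).
Proof.
move=> ab tx [mu_ Uu]; have [B xB] := traj_bounded ab tx.
have cm := maxd_continuous ab tau0 tx.
have cF p q (F : 'cV[R]_n -> 'cV[R]_n -> 'M[R]_(p, q)) k l : lip2 F L ->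
    measurable_fun setT (fun s => F (x s) (maxd tau x s) k l).
  move=> FL; apply: continuous_measurable_fun => s.
  have cF : continuous (fun p : 'cV[R]_n * 'cV[R]_n => F p.1 p.2).
    apply: (@lip_continuous _ _ _ _ L) => -[c d] [c' d']; apply: FL => /=.
      by rewrite [leRHS]/Num.norm/= le_max lexx.
    by rewrite [leRHS]/Num.norm/= le_max lexx orbT.
  apply: (@continuous_comp _ _ _ (fun s => F (x s) (maxd tau x s)) (fun A : 'M[R]_(p, q) => A k l)).
    apply: (@continuous_comp _ _ _ (fun s => (x s, maxd tau x s)) (fun p : 'cV[R]_n * 'cV[R]_n => F p.1 p.2)).
      by have [cx _] := tx; exact: (cvg_pair (cx s) (cm s)).
    exact: cF.
  exact: coord_continuous.
split.
  under eq_fun do rewrite /rhs mxE [X in _ + X]mxE.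
  apply: measurable_funD; first exact: cF.
  by apply: measurable_sum => l; apply: measurable_funM => //; exact: cF.
exists (growth_const + lip_const * B) => s; apply: le_trans (entry_le_norm _ i 0) _.
by apply: (field_bound xB _ (Uu s)) => r _; exact: xB.
Qed.

End right_hand_side.

Section limits.
Context {R : realType}.

Lemma le0_eps (V : normedModType R) (a : V) K : (forall e, 0 < e -> `|a| <= K * e) -> a = 0.
Proof.
move=> h; apply/eqP; rewrite -normr_le0; apply/ler_addgt0Pr => e e0; rewrite add0r.
have K1 : 0 < `|K| + 1 by rewrite ltr_wpDl.
apply: (le_trans (h (e / (`|K| + 1)) _)); first by rewrite divr_gt0.
rewrite mulrCA -[leRHS]mulr1 ler_wpM2l ?(ltW e0)// ler_pdivrMr// mul1r.
by rewrite (le_trans (ler_norm K))// lerDl.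
Qed.

(** Monotone envelopes: [b] decreases, [c] increases, and every [c j] lies below every [b k], so the
    supremum of [c] separates them. *)
Lemma geometric_limit (a : nat -> R) C :
  (forall k, `|a k.+1 - a k| <= C * 2^-1 ^+ k) ->
  exists l, forall k, `|a k - l| <= 2 * C * 2^-1 ^+ k.
Proof.
(* The half-width shrinks by exactly [C * 2^-1 ^+ k] at step [k], the size allowed for the
   increment. *)
move=> h; pose b k := a k + 2 * C * 2^-1 ^+ k; pose c k := a k - 2 * C * 2^-1 ^+ k.
have C0 : 0 <= C by have := h 0; rewrite expr0 mulr1; exact: le_trans.
have p0 k : 0 <= C * 2^-1 ^+ k by rewrite mulr_ge0// exprn_ge0.
have bd : {homo b : k j / (k <= j)%N >-> j <= k}.
  apply: homo_leq => [//|x y z xy yz|k]; first exact: le_trans yz xy.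
  by have := h k; rewrite ler_norml /b exprS => /andP[_]; lra.
have cd : {homo c : k j / (k <= j)%N >-> k <= j}.
  apply: homo_leq => [//|x y z|k]; first exact: le_trans.
  by have := h k; rewrite ler_norml /c exprS => /andP[+ _]; lra.
have cb j k : c j <= b k.
  apply: (le_trans (cd _ _ (leq_maxl j k))); apply: (le_trans _ (bd _ _ (leq_maxr j k))).
  by rewrite /b /c; have := p0 (maxn j k); lra.
have ub : has_ubound (range c) by exists (b 0) => _ [j _ <-].
exists (sup (range c)) => k.
have h1 : c k <= sup (range c) by apply: ub_le_sup => //; exists k.
have h2 : sup (range c) <= b k.
  by apply: ge_sup; [exists (c 0), 0%N|move=> _ [j _ <-]].
by rewrite ler_norml; move: h1 h2; rewrite /b /c => *; apply/andP; split; lra.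
Qed.

Lemma half_small (C e : R) : 0 < e -> exists k, C * 2^-1 ^+ k <= e.
Proof.
move=> e0.
have [C0|C0] := leP C 0.
  by exists 0; rewrite expr0 mulr1 (le_trans C0)// ltW.
have : (2^-1 : R) ^+ k @[k --> \oo] --> 0.
  by apply: cvg_expr; rewrite ger0_norm// invf_lt1// ltr1n.
move/cvgrPdist_le/(_ (e / C)); rewrite divr_gt0// => /(_ isT)[k _ /(_ k (leqnn _))].
rewrite sub0r normrN ger0_norm ?exprn_ge0// => h; exists k.
by rewrite mulrC -ler_pdivlMr.
Qed.

(** One approximating member for each [e] is enough, so the lemma serves for cluster points as well
    as for limits. *)
Lemma traj_lim n (a b : R) (z : nat -> R -> 'cV[R]_n) y : (forall k, traj a b (z k)) ->
  (forall e, 0 < e -> exists k, forall s, `|z k s - y s| <= e) -> traj a b y.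
Proof.
move=> tz zy; split=> [s|s].
  apply/cvgrPdist_le => e e0.
  have e3 : 0 < e / 3 by rewrite divr_gt0.
  have [k hk] := zy _ e3; have [cz _] := tz k.
  have /cvgrPdist_le/(_ _ e3) := cz s; apply: filterS => r zsr.
  rewrite -(subrKA (z k s)) -(subrKA (z k r) (z k s)).
  have := hk r; have := hk s; rewrite (distrC _ (y s)) => h1 h2.
  apply: (le_trans (ler_normD _ _)); apply: le_trans (lerD h1 (ler_normD _ _)) _.
  by apply: le_trans (lerD (lexx _) (lerD zsr h2)) _; lra.
apply/eqP; rewrite -subr_eq0; apply/eqP/(@le0_eps _ _ 2) => e e0.
have [k hk] := zy _ e0; have [_ zE] := tz k.
have := hk (clamp a b s); rewrite -zE => h2.
rewrite -(subrKA (z k s)) mulrDl mul1r (le_trans (ler_normD _ _))// lerD//.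
by rewrite distrC.
Qed.

Lemma clamp_min (a b s : R) : a <= b -> s <= a -> clamp a b s = a.
Proof. by move=> ab sa; rewrite /clamp (min_idPr (le_trans sa ab)) (max_idPl sa). Qed.

Lemma clamp_max (a b s : R) : a <= b -> b <= s -> clamp a b s = b.
Proof. by move=> ab bs; rewrite /clamp (min_idPl bs) (max_idPr ab). Qed.

Lemma clamp_clampl (a b s : R) : a <= 0 -> 0 <= b -> clamp a 0 (clamp a b s) = clamp a 0 s.
Proof.
move=> a0 b0; have ab := le_trans a0 b0.
have [sa|as_] := leP s a; first by rewrite !clamp_min.
have [bs|sb] := leP b s; last by rewrite (clamp_id (a := a) (b := b)) ?ltW.
by rewrite !clamp_max// (le_trans b0).
Qed.

Lemma clamp_clampr (a b s : R) : a <= 0 -> 0 <= b -> clamp 0 b (clamp a b s) = clamp 0 b s.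
Proof.
move=> a0 b0; have ab := le_trans a0 b0.
have [sa|as_] := leP s a; first by rewrite !clamp_min// (le_trans sa).
have [bs|sb] := leP b s; last by rewrite (clamp_id (a := a) (b := b)) ?ltW.
by rewrite !clamp_max.
Qed.

Lemma clamp_comp_continuous (V : topologicalType) (a b : R) (f : R -> V) : a <= b ->
  {within [set` `[a, b]], continuous f} -> continuous (f \o clamp a b).
Proof.
move=> ab cf s.
have /subspace_continuousP/(_ (clamp a b s)) := cf.
rewrite /= in_itv/= clamp_itv// => /(_ isT) h.
apply: (cvg_comp _ _ _ h) => P wP.
have := @clamp_continuous _ a b s _ wP; rewrite /= !nbhs_simpl/=.
apply: filterS => r /=; apply.
by rewrite in_itv/= clamp_itv.
Qed.

End limits.

(** * Existence of states and a bound independent of the control *)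

Section states.
Context {R : realType} {n m : nat} (T tau : R)
  (F0 : 'cV[R]_n -> 'cV[R]_n -> 'cV[R]_n)
  (F1 : 'cV[R]_n -> 'cV[R]_n -> 'M[R]_(n, m))
  (phi : R -> 'cV[R]_n) (U : set 'cV[R]_m) (L M : R)
  (L0 : 0 <= L) (F0L : lip2 F0 L) (F1L : lip2 F1 L) (M0 : 0 <= M)
  (UM : forall w, U w -> `|w| <= M) (tau0 : 0 <= tau) (T0 : 0 <= T)
  (cphi : {within [set` `[- tau, 0]], continuous phi}).
Implicit Types (x y : R -> 'cV[R]_n) (u : R -> 'cV[R]_m).
Local Notation field := (rhs tau F0 F1).
Local Notation K := (@lip_const R m L M).
Local Notation A := (growth_const F0 F1 M).

(* Integral form of the state equation, for the extension of the state by constants. *)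
Definition istate u x := [/\ traj (- tau) T x,
  forall s, - tau <= s <= 0 -> x s = phi s &
  forall t, 0 <= t <= T -> forall i,
    x t i 0 = phi 0 i 0 + Int (fun s => field x s (u s) i 0) t].

Lemma lerN_delay : - tau <= T. Proof. by rewrite (le_trans _ T0)// oppr_le0. Qed.
Lemma oppr_delay_le0 : - tau <= 0. Proof. by rewrite oppr_le0. Qed.
Lemma lip_const_ge0 : 0 <= K. Proof. by rewrite /lip_const addr_ge0// !mulr_ge0. Qed.
Lemma growth_const_ge0 : 0 <= A. Proof. by rewrite /growth_const addr_ge0// !mulr_ge0. Qed.

Lemma Int_field_dist x y u t e i : traj (- tau) T x -> traj (- tau) T y -> ctrl U u ->
  0 <= t -> (forall s, s <= t -> `|x s - y s| <= e) ->
  `|Int (fun s => field x s (u s) i 0) t - Int (fun s => field y s (u s) i 0) t|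
    <= K * e * t.
Proof.
move=> tx ty cu t0 xy.
have [B xB] := traj_bounded lerN_delay tx; have [C yC] := traj_bounded lerN_delay ty.
have bx := field_bmeas F0L F1L UM tau0 i lerN_delay tx cu.
have by_ := field_bmeas F0L F1L UM tau0 i lerN_delay ty cu.
rewrite -IntB//; apply: Int_bound => //; first exact: bmeasB.
move=> s /andP[s0 st].
have := field_dist F0L F1L UM tau0 xB yC (fun r rs => xy r (le_trans rs st)) (cu.2 s).
by apply: le_trans; apply: le_trans (entry_le_norm _ i 0); rewrite !mxE.
Qed.

(** The history frozen at [phi 0] after time 0: the starting point of the Picard iteration. *)
Definition phic s := phi (clamp (- tau) 0 s).

Lemma phic_traj : traj (- tau) T phic.
Proof.
split=> s; last by rewrite /phic clamp_clampl// oppr_delay_le0.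
exact: (clamp_comp_continuous oppr_delay_le0 cphi).
Qed.

(** The clamp in the upper limit makes the integral vanish on the history and stay constant after
    [T], so the image is again a trajectory and equals [phi] on the history. *)
Definition picard u y s := phic s +
  \col_i Int (fun r => field y r (u r) i 0) (clamp 0 T s).

Lemma col_norm_le (f : 'I_n -> R) e : 0 <= e -> (forall i, `|f i| <= e) -> `|\col_i f i| <= e.
Proof. by move=> e0 fe; apply: colv_le_norm => // i; rewrite mxE. Qed.

Lemma picard_traj u y : ctrl U u -> traj (- tau) T y -> traj (- tau) T (picard u y).
Proof.
move=> cu ty; have [cphic phicE] := phic_traj; have [B yB] := traj_bounded lerN_delay ty.
have B0 : 0 <= B by exact: le_trans (yB 0).
split=> s; last first.
  by rewrite /picard -phicE clamp_clampr// oppr_delay_le0.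
apply: cvgD; first exact: cphic.
pose f s := \col_i Int (fun r => field y r (u r) i 0) (clamp 0 T s).
suff : continuous f by exact.
apply: (@lip_continuous _ _ _ _ (A + K * B)) => {}s r; rewrite /f.
have -> : (\col_i Int (fun r => field y r (u r) i 0) (clamp 0 T s)) -
   (\col_i Int (fun r => field y r (u r) i 0) (clamp 0 T r)) =
   \col_i (Int (fun r => field y r (u r) i 0) (clamp 0 T s) -
           Int (fun r => field y r (u r) i 0) (clamp 0 T r)).
  by apply/colP => i; rewrite !mxE.
have AB0 : 0 <= A + K * B by rewrite addr_ge0 ?mulr_ge0 ?growth_const_ge0 ?lip_const_ge0.
apply: col_norm_le => [|i]; first by rewrite mulr_ge0.
apply: (@le_trans _ _ ((A + K * B) * `|clamp 0 T s - clamp 0 T r|)); last first.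
  by rewrite ler_wpM2l// clamp_lip.
have bf := field_bmeas F0L F1L UM tau0 i lerN_delay ty cu.
apply: Int_lip => //; last 2 first.
- by case/andP: (clamp_itv r T0).
- by case/andP: (clamp_itv s T0).
move=> q; apply: le_trans (entry_le_norm _ i 0) _.
by apply: (field_bound F0L F1L UM tau0 yB _ (cu.2 q)) => p _; exact: yB.
Qed.

(** Chosen so that [K] divided by the rate is at most 1/2; the added 1 keeps the rate positive when
    [K] vanishes. *)
Definition bielecki_rate : R := 2 * (K + 1).

Lemma bielecki_rate_gt0 : 0 < bielecki_rate.
Proof. by rewrite mulr_gt0// ltr_wpDl// lip_const_ge0. Qed.

Lemma bielecki_rate_half : K * bielecki_rate^-1 <= 2^-1.
Proof.
rewrite ler_pdivrMr ?bielecki_rate_gt0// /bielecki_rate mulrA mulVf// mul1r lerDl//.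
Qed.

(** At time [r] the two trajectories differ on the whole past by at most [D] times the weight at
    [r], so the Lipschitz bound applies despite the delay; integrating the weight gains the inverse
    of the rate. *)
Lemma picard_contract u x y D : ctrl U u -> traj (- tau) T x -> traj (- tau) T y ->
  0 <= D -> (forall s, `|x s - y s| <= D * weight bielecki_rate T s) ->
  forall s, `|picard u x s - picard u y s| <= D * 2^-1 * weight bielecki_rate T s.
Proof.
move=> cu tx ty D0 xy s.
have [B xB] := traj_bounded lerN_delay tx; have [C yC] := traj_bounded lerN_delay ty.
have w0 r : 0 <= weight bielecki_rate T r := ltW (weight_gt0 bielecki_rate T r).
have lw0 := ltW bielecki_rate_gt0.
rewrite /picard opprD addrACA subrr add0r.
have -> : (\col_i Int (fun r => field x r (u r) i 0) (clamp 0 T s)) -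
   (\col_i Int (fun r => field y r (u r) i 0) (clamp 0 T s)) =
   \col_i (Int (fun r => field x r (u r) i 0) (clamp 0 T s) -
           Int (fun r => field y r (u r) i 0) (clamp 0 T s)).
  by apply/colP => i; rewrite !mxE.
apply: col_norm_le => [|i]; first by rewrite !mulr_ge0.
have bx := field_bmeas F0L F1L UM tau0 i lerN_delay tx cu.
have by_ := field_bmeas F0L F1L UM tau0 i lerN_delay ty cu.
have bw := bmeas_weight lw0 T0.
set t := clamp 0 T s; have tT : 0 <= t <= T := clamp_itv s T0.
rewrite -IntB//.
apply: (@le_trans _ _ (Int (fun r => K * D * weight bielecki_rate T r) t)).
  apply: le_normr_Int; [exact: bmeasB|exact: bmeasZ|move=> r /andP[r0 rt]].
  have := @field_dist _ _ _ _ F0 F1 U L M F0L F1L UM tau0 x y r (u r) (D * weight bielecki_rate T r) B C xB yC.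
  rewrite -mulrA => /(_ _ (cu.2 r)) h.
  apply: le_trans (h _); first by apply: le_trans (entry_le_norm _ i 0); rewrite !mxE.
  by move=> q qr; apply: (le_trans (xy q)); rewrite ler_wpM2l// weight_le.
rewrite IntZ//; apply: (@le_trans _ _ (K * D * (bielecki_rate^-1 * weight bielecki_rate T t))).
  by rewrite ler_wpM2l ?mulr_ge0 ?lip_const_ge0// Int_weight ?bielecki_rate_gt0.
have -> : weight bielecki_rate T t = weight bielecki_rate T s by rewrite /weight /t (clamp_id (clamp_itv s T0)).
rewrite mulrA ler_wpM2r// mulrAC mulrC ler_wpM2l//; exact: bielecki_rate_half.
Qed.

Lemma state_exists u : ctrl U u -> exists x, istate u x.
Proof.
move=> cu; pose z k := iter k (picard u) phic.
have tz k : traj (- tau) T (z k).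
  by elim: k => [|k IH]; [exact: phic_traj|exact: picard_traj].
have [B0 hB0] := traj_bounded lerN_delay (tz 0); have [B1 hB1] := traj_bounded lerN_delay (tz 1).
pose D := B1 + B0.
have D0 : 0 <= D.
  by rewrite addr_ge0//; [exact: le_trans (hB1 0)|exact: le_trans (hB0 0)].
have lw0 := ltW bielecki_rate_gt0.
have step k s : `|z k.+1 s - z k s| <= D * 2^-1 ^+ k * weight bielecki_rate T s.
  elim: k s => [|k IH] s.
    rewrite expr0 mulr1 -[leLHS]mulr1 ler_pM ?weight_ge1//.
    by rewrite (le_trans (ler_normB _ _))// lerD.
  rewrite exprSr mulrA; apply: picard_contract => //; first exact: (tz k.+1).
  by rewrite mulr_ge0// exprn_ge0.
pose C := D * expR (bielecki_rate * T).
have C0 : 0 <= C by rewrite mulr_ge0// ltW// expR_gt0.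
have stepC s i k : `|z k.+1 s i 0 - z k s i 0| <= C * 2^-1 ^+ k.
  have : `|z k.+1 s - z k s| <= C * 2^-1 ^+ k.
    apply: (le_trans (step k s)); rewrite /C mulrAC ler_wpM2r ?exprn_ge0//.
    by rewrite ler_wpM2l// weight_bound.
  by apply: le_trans; apply: le_trans (entry_le_norm _ i 0); rewrite !mxE.
have /choice[l hl] : forall si : R * 'I_n, exists l, forall k,
    `|z k si.1 si.2 0 - l| <= 2 * C * 2^-1 ^+ k.
  by move=> [s i]; exact: (geometric_limit (stepC s i)).
pose y s := \col_i l (s, i).
have zy k s : `|z k s - y s| <= 2 * C * 2^-1 ^+ k.
  apply: colv_le_norm => [|i]; first by rewrite !mulr_ge0// exprn_ge0.
  by rewrite !mxE; exact: (hl (s, i)).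
have ty : traj (- tau) T y.
  apply: (traj_lim tz) => e e0; have [k hk] := half_small (2 * C) e0.
  by exists k => s; exact: le_trans (zy k s) hk.
(* A value that the iterates approach at a geometric rate is the value of [y]. The constant [B] is 0
   on the history, where the iterates are exact, and comes from [Int_field_dist] in the integral
   equation. *)
have lim s (c : 'cV[R]_n) B : 
    (forall k, `|z k.+1 s - c| <= B * 2^-1 ^+ k) -> y s = c.
  move=> zc; apply/eqP; rewrite -subr_eq0; apply/eqP/(@le0_eps _ 'cV[R]_n (y s - c) 1) => e e0.
  have [k hk] := half_small (2 * C + B) e0.
  rewrite mul1r; apply: le_trans hk; rewrite -(subrKA (z k.+1 s)) mulrDl.
  rewrite (le_trans (ler_normD _ _))// lerD// distrC (le_trans (zy _ _))//.
  rewrite ler_wpM2l ?mulr_ge0// exprS ler_piMl ?exprn_ge0//.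
  by rewrite invf_le1// ler1n.
exists y; split => //.
  move=> s /[dup] sI /andP[_ s0]; apply: (lim _ _ 0) => k.
  rewrite mul0r normr_le0 subr_eq0 /z /= /picard; apply/eqP.
  rewrite /phic clamp_id//; apply/colP => i; rewrite !mxE.
  have -> : clamp 0 T s = 0.
    by rewrite /clamp (min_idPr (le_trans s0 T0)) (max_idPl s0).
  by rewrite Int0 ?addr0//; exact: (field_bmeas F0L F1L UM tau0 i lerN_delay (tz k) cu).
move=> t tT i; have /andP[t0 tT'] := tT.
pose c := phi 0 + \col_i Int (fun s => field y s (u s) i 0) t.
suff -> : y t = c by rewrite !mxE.
apply: (lim _ _ (K * (2 * C) * t)) => k.
have -> : z k.+1 t - c = \col_i (Int (fun s => field (z k) s (u s) i 0) t -
    Int (fun s => field y s (u s) i 0) t).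
  apply/colP => j; rewrite /z /= -/(z k) /picard /c clamp_id// !mxE /phic.
  have -> : clamp (- tau) 0 t = 0.
    by rewrite /clamp (min_idPl t0) (max_idPr oppr_delay_le0).
  by rewrite opprD addrACA subrr add0r.
apply: col_norm_le => [|j]; first by rewrite !mulr_ge0 ?lip_const_ge0// exprn_ge0.
rewrite mulrAC -(mulrA K); apply: Int_field_dist => // s _; exact: zy.
Qed.

(** Gronwall by a maximum argument. Where the norm of [x] divided by the weight is largest, either
    the history bounds it, or the integral equation bounds the norm of [x] by the data plus half of
    itself. The control enters only through [M], hence the order of the quantifiers. *)
Lemma state_bounded : exists C, forall u x, ctrl U u -> istate u x -> forall s, `|x s| <= C.
Proof.
have [P hP] := traj_bounded lerN_delay phic_traj.
have P0 : 0 <= P by exact: le_trans (hP 0).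
have lw0 := ltW bielecki_rate_gt0.
(* [P] bounds the history and [A * T] the growth at the zero trajectory; the factor 2 comes from
   absorbing one half. *)
pose C := 2 * (P + A * T).
have C0 : 0 <= C by rewrite mulr_ge0// addr_ge0// mulr_ge0// growth_const_ge0.
exists (C * expR (bielecki_rate * T)) => u x cu [tx xphi xI].
have [cx xE] := tx.
have [B xB] := traj_bounded lerN_delay tx.
have w0 r : 0 < weight bielecki_rate T r := weight_gt0 bielecki_rate T r.
have [|c cI hc] := @EVT_max R (fun s => `|x s| / weight bielecki_rate T s) (- tau) T lerN_delay.
  apply: continuous_subspaceT => s; apply: cvgM.
    by apply: continuous_comp (cx s) _; exact: norm_continuous.
  by apply: cvgV; [rewrite gt_eqF|exact: weight_continuous].
pose k := `|x c| / weight bielecki_rate T c.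
have k0 : 0 <= k by rewrite divr_ge0// ltW.
have clampw s : weight bielecki_rate T (clamp (- tau) T s) = weight bielecki_rate T s.
  by rewrite /weight clamp_clampr ?oppr_delay_le0.
have xk s : `|x s| <= k * weight bielecki_rate T s.
  rewrite -ler_pdivrMr// xE -clampw; apply: hc.
  by rewrite in_itv/= clamp_itv// lerN_delay.
suff kC : k <= C.
  move=> s; apply: (le_trans (xk s)); apply: ler_pM => //; first exact: ltW.
  exact: weight_bound.
move: (cI); rewrite in_itv/= => /andP[c1 c2].
have [cle0|cgt0] := leP c 0.
  have : `|x c| <= P.
    by rewrite xphi ?c1//; have := hP c; rewrite /phic clamp_id// c1.
  rewrite /k => xP; rewrite ler_pdivrMr//; apply: (le_trans xP).
  apply: (@le_trans _ _ (C * 1)); last by rewrite ler_wpM2l// weight_ge1.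
  by rewrite /C; have := mulr_ge0 growth_const_ge0 T0; lra.
have cT : 0 <= c <= T by rewrite ltW.
have : `|x c| <= P + (A * T + 2^-1 * (k * weight bielecki_rate T c)).
  have -> : x c = phi 0 + \col_i Int (fun s => field x s (u s) i 0) c.
    by apply/colP => i; rewrite !mxE; exact: xI.
  rewrite (le_trans (ler_normD _ _))// lerD//.
    by have := hP 0; rewrite /phic clamp_id// oppr_delay_le0 lexx.
  have kw0 : 0 <= k * weight bielecki_rate T c by rewrite mulr_ge0// ltW.
  apply: col_norm_le => [|i]; first by apply: addr_ge0; apply: mulr_ge0 => //; exact: growth_const_ge0.
  have bw := bmeas_weight lw0 T0.
  apply: (@le_trans _ _ (Int (fun r => A + K * k * weight bielecki_rate T r) c)).
    apply: le_normr_Int.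
    - exact: (field_bmeas F0L F1L UM tau0 i lerN_delay).
    - by apply: bmeasD; [exact: bmeas_cst|exact: bmeasZ].
    - move=> r /andP[r0 rc]; apply: le_trans (entry_le_norm _ i 0) _.
      rewrite -mulrA; apply: (field_bound F0L F1L UM tau0 xB _ (cu.2 r)) => q qr.
      by apply: (le_trans (xk q)); rewrite ler_wpM2l// weight_le.
  rewrite IntD//; [|exact: bmeas_cst|exact: bmeasZ].
  rewrite IntZ// Int_cst ?(ltW cgt0)//; apply: lerD.
    by rewrite ler_wpM2l ?growth_const_ge0.
  apply: (@le_trans _ _ (K * k * (bielecki_rate^-1 * weight bielecki_rate T c))).
    apply: ler_wpM2l; first by apply: mulr_ge0 => //; exact: lip_const_ge0.
    by apply: Int_weight; [exact: bielecki_rate_gt0|].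
  rewrite mulrACA ler_wpM2r//; exact: bielecki_rate_half.
have -> : `|x c| = k * weight bielecki_rate T c by rewrite /k divfK// lt0r_neq0.
move=> h.
have w1 : 1 <= weight bielecki_rate T c by exact: weight_ge1.
have : k * weight bielecki_rate T c <= C * weight bielecki_rate T c; last by rewrite ler_pM2r.
apply: (@le_trans _ _ (C * 1)); last by rewrite ler_wpM2l.
by rewrite /C mulr1; lra.
Qed.

End states.

Lemma fmap_ultra (S X : Type) (f : S -> X) (G : set_system S) :
  UltraFilter G -> UltraFilter (f @ G).
Proof.
move=> UG; split; first exact: fmap_proper_filter.
move=> H PH GH; apply/seteqP; split => A; last exact: GH.
move=> HA; have [//|GnA] := in_ultra_setVsetC (f @^-1` A) UG.
have HnA : H (~` A) by apply: GH.
have : H set0 by rewrite -(setICr A); exact: filterI.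
by move/filter_not_empty.
Qed.

Lemma ler_dist3 (R : realType) (V : normedModType R) (a b c d : V) :
  `|a - d| <= `|a - b| + `|b - c| + `|c - d|.
Proof.
rewrite -(subrKA c a) -(subrKA b a) (le_trans (ler_normD _ _))// lerD2r.
exact: ler_normD.
Qed.

(** * Compactness of the states *)

Section Arzela_Ascoli.
Context {R : realType} {n : nat} (tau T : R) (tau0 : 0 <= tau) (T0 : 0 <= T).

(** The Lipschitz bound is asked on [0, T] only, since [phi] is merely continuous; on the history
    all functions agree. Uniform closeness at arbitrarily late indices lets a subsequence be picked
    by choice. *)
Lemma equilipschitz_cluster (phi : R -> 'cV[R]_n) (x : nat -> R -> 'cV[R]_n) C D :
  (forall k, traj (- tau) T (x k)) ->
  (forall k s, - tau <= s <= 0 -> x k s = phi s) ->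
  (forall k s, `|x k s| <= C) ->
  (forall k s r, 0 <= s <= T -> 0 <= r <= T -> `|x k s - x k r| <= D * `|s - r|) ->
  exists y, forall e, 0 < e -> forall N, exists2 k, (N <= k)%N & forall s, `|x k s - y s| <= e.
Proof.
move=> tx xphi xC xD.
(* Pointwise limit along an ultrafilter; equicontinuity makes it uniform. *)
have [G [UG NG]] := @ultraFilterLemma nat \oo _.
have hex : forall si : R * 'I_n, exists l : R, x k si.1 si.2 0 @[k --> G] --> l.
  move=> [s i] /=.
  have := @segment_compact R (- C) C; rewrite compact_ultra.
  move=> /(_ ((fun k => x k s i 0) @ G) (fmap_ultra _ UG))[].
    apply: (@filterE _ G _ ((fun k => x k s i 0) @^-1` `[- C, C]%classic)) => k.
    rewrite /= in_itv/= -ler_norml.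
    exact: (le_trans (entry_le_norm _ _ _) (xC k s)).
  by move=> l [_ hl]; exists l.
have [l hl] := choice hex.
pose y0 s : 'cV[R]_n := \col_i l (s, i).
have y0P s e : 0 < e -> \forall k \near G, `|x k s - y0 s| <= e.
  move=> e0.
  have : \forall k \near G, forall i, `|l (s, i) - x k s i 0| <= e.
    by apply: filter_forall => i; have /cvgrPdist_le := hl (s, i); exact.
  apply: filterS => k h; apply: colv_le_norm => [|i]; first exact: ltW.
  by rewrite !mxE distrC.
have y0phi s : - tau <= s <= 0 -> y0 s = phi s.
  move=> sI; apply/eqP; rewrite eq_sym -subr_eq0; apply/eqP/(@le0_eps _ 'cV[R]_n _ 1) => e e0.
  have [k hk] := filter_ex (y0P s _ e0).
  by rewrite mul1r -(xphi k).
have y0D s r : 0 <= s <= T -> 0 <= r <= T -> `|y0 s - y0 r| <= D * `|s - r|.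
  move=> sI rI; apply/ler_addgt0Pr => e e0.
  have e2 : 0 < e / 2 by rewrite divr_gt0.
  have [k [h1 h2]] := filter_ex (filterI (y0P s _ e2) (y0P r _ e2)).
  rewrite -(subrKA (x k s)) -(subrKA (x k r) (x k s)) (splitr e).
  have h3 := xD k s r sI rI; rewrite distrC in h1.
  by have := ler_normD (y0 s - x k s) (x k s - x k r + (x k r - y0 r));
     have := ler_normD (x k s - x k r) (x k r - y0 r); lra.
have unif e : 0 < e -> \forall k \near G, forall s, 0 <= s <= T -> `|x k s - y0 s| <= e.
  move=> e0.
  have D1 : 0 < `|D| + 1 by rewrite ltr_wpDl.
  have e3 : 0 < e / 3 by rewrite divr_gt0.
  (* A third of [e] for the value at [s], a third each for moving [x k] and [y0] from [s] to a
     nearby [r]; compactness makes the set of indices uniform. *)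
  have /compact_near_coveringP/(_ nat G
    (fun k s => `|x k (clamp 0 T s) - y0 (clamp 0 T s)| <= e) _) := @segment_compact R 0 T.
  case: (boolP true) => // _ h.
  have {}h : \forall k \near G, `[0, T] `<=` (fun s => `|x k (clamp 0 T s) - y0 (clamp 0 T s)| <= e).
    apply: h => s sI.
    exists (ball s (e / 3 / (`|D| + 1)), [set k | `|x k (clamp 0 T s) - y0 (clamp 0 T s)| <= e / 3]).
      split; first by apply: nbhsx_ballx; rewrite divr_gt0.
      exact: y0P.
    move=> [r k] /= [sr hk].
    have bnd : D * `|clamp 0 T s - clamp 0 T r| <= e / 3.
      apply: (@le_trans _ _ ((`|D| + 1) * `|s - r|)).
        apply: (@le_trans _ _ ((`|D| + 1) * `|clamp 0 T s - clamp 0 T r|)).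
          by rewrite ler_wpM2r// (le_trans (ler_norm D))// lerDl.
        by rewrite ler_wpM2l ?(ltW D1)// clamp_lip.
      by rewrite mulrC -ler_pdivlMr// ltW.
    have h1 := xD k _ _ (clamp_itv s T0) (clamp_itv r T0).
    have h2 := y0D _ _ (clamp_itv s T0) (clamp_itv r T0).
    rewrite distrC in h1.
    have := ler_dist3 (x k (clamp 0 T r)) (x k (clamp 0 T s)) (y0 (clamp 0 T s)) (y0 (clamp 0 T r)).
    lra.
  apply: filterS h => k h s sI.
  by have := h s; rewrite clamp_id//; apply; rewrite /= in_itv.
(* Uniform closeness to [y0] is known on the history and on [0, T]; beyond, the values at the end
   points are used. *)
exists (fun s => y0 (clamp (- tau) T s)) => e e0 N.
have GN : G [set k | (N <= k)%N] by apply: NG; exists N.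
have [k [/= hk Nk]] := filter_ex (filterI (unif _ e0) GN).
exists k => // s; have [_ ->] := tx k.
have /andP[s1 s2] : - tau <= clamp (- tau) T s <= T.
  by apply: clamp_itv; rewrite (le_trans _ T0)// oppr_le0.
set r := clamp _ _ _ in s1 s2 *.
have [r0|/ltW r0] := leP r 0; last by apply: hk; rewrite r0.
by rewrite xphi ?s1// y0phi ?s1// subrr normr0 ltW.
Unshelve. all: by end_near.
Qed.

End Arzela_Ascoli.

(** * Almost everywhere convergence of midpoints *)

Section convergence_of_means.
Context {R : realType}.
Notation mu := (@lebesgue_measure R).
Context {W : Type} {m : nat} (pr : W -> R -> 'cV[R]_m) (T M : R)
  (H : nat -> set W) (T0 : 0 <= T)
  (Hne : forall k, H k !=set0)
  (Hdec : forall k l, (k <= l)%N -> H l `<=` H k)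
  (Hmid : forall k v w, H k v -> H k w ->
    exists2 c, H k c & forall s, pr c s = 2^-1 *: (pr v s + pr w s))
  (Hmeas : forall v, H 0 v -> forall l, measurable_fun setT (fun s => pr v s l 0))
  (Hbnd : forall v, H 0 v -> forall s, `|pr v s| <= M).

Definition nrm2 (f : R -> 'cV[R]_m) := Int (fun s => \sum_l f s l 0 ^+ 2) T.

Lemma bmeas_pr v l : H 0 v -> bmeas (fun s => pr v s l 0).
Proof.
move=> Hv; split; first exact: Hmeas.
by exists M => s; apply: le_trans (Hbnd Hv s); exact: entry_le_norm.
Qed.

Lemma bmeas_sumsq (f : R -> 'cV[R]_m) : (forall l, bmeas (fun s => f s l 0)) ->
  bmeas (fun s => \sum_l f s l 0 ^+ 2).
Proof. by move=> bf; apply: bmeas_sum => l; under eq_fun do rewrite expr2; exact: bmeasM. Qed.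

Lemma nrm2_ge0 f : 0 <= nrm2 f.
Proof. by apply: Rintegral_ge0 => s _; apply: sumr_ge0 => l _; exact: sqr_ge0. Qed.

Lemma nrm2_parallelogram (f g : R -> 'cV[R]_m) : (forall l, bmeas (fun s => f s l 0)) ->
  (forall l, bmeas (fun s => g s l 0)) ->
  nrm2 (fun s => f s - g s) = 2 * nrm2 f + 2 * nrm2 g - 4 * nrm2 (fun s => 2^-1 *: (f s + g s)).
Proof.
move=> bf bg; rewrite /nrm2.
have bh : forall l, bmeas (fun s => (2^-1 *: (f s + g s)) l 0).
  by move=> l; under eq_fun do rewrite !mxE; apply: bmeasZ; exact: bmeasD.
rewrite -!IntZ; try exact: bmeas_sumsq.
rewrite -IntD; try (apply: bmeasZ; exact: bmeas_sumsq).
rewrite -IntB; [|apply: bmeasD|]; try (apply: bmeasZ; exact: bmeas_sumsq).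
congr (Int _ T); apply/funext => s.
rewrite !mulr_sumr -big_split/= -sumrB; apply: eq_bigr => l _.
by rewrite !mxE; field.
Qed.

(** The projection argument for convex sets, along a decreasing family: the infima [d k] of the
    squared norm increase to a finite [D]. Almost minimal elements far along have squared norm at
    most about [D], their midpoints at least about [D], so the parallelogram law makes consecutive
    elements close. [W] may carry data beyond the function [pr]; here the running cost. *)
Lemma minimizing_sequence : exists N : nat -> nat, exists v : nat -> W,
  [/\ forall k, (k <= N k)%N, forall k, H (N k) (v k) &
      forall k, nrm2 (fun s => pr (v k.+1) s - pr (v k) s) <= 4^-1 ^+ k].
Proof.
pose Q k := [set nrm2 (pr v) | v in H k].
have Qne k : Q k !=set0 by have [v Hv] := Hne k; exists (nrm2 (pr v)), v.
have Qlb k : has_lbound (Q k) by exists 0 => _ [v _ <-]; exact: nrm2_ge0.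
pose d k := inf (Q k).
have H0 k v : H k v -> H 0 v by apply: Hdec.
have dk k v : H k v -> d k <= nrm2 (pr v) by move=> Hv; apply: ge_inf => //; exists v.
have dd k l : (k <= l)%N -> d k <= d l.
  move=> kl; apply: lb_le_inf => // _ [v Hv <-]; apply: dk; exact: Hdec Hv.
have dub : has_ubound (range d).
  exists (m%:R * M ^+ 2 * T) => _ [k _ <-]; have [v Hv] := Hne k.
  apply: (le_trans (dk k v Hv)).
  rewrite /nrm2; apply: (le_trans (ler_norm _)); apply: Int_bound => //.
    by apply: bmeas_sumsq => l; apply: bmeas_pr; exact: H0 Hv.
  move=> s _; rewrite ger0_norm; last by apply: sumr_ge0 => l _; exact: sqr_ge0.
  have -> : m%:R * M ^+ 2 = \sum_(l < m) M ^+ 2.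
    by rewrite sumr_const card_ord mulr_natl.
  apply: ler_sum => l _; rewrite -real_normK ?num_real// ler_pXn2r ?nnegrE//.
    by apply: le_trans (Hbnd (H0 _ _ Hv) s); exact: entry_le_norm.
  by apply: le_trans (Hbnd (H0 _ _ Hv) s).
have dne : range d !=set0 by exists (d 0), 0%N.
pose D := sup (range d).
have dD k : d k <= D by apply: ub_le_sup => //; exists k.
(* The parallelogram law costs 2 + 2 + 4 = 8 such errors; the resulting rate 4^-k has the summable
   square root 2^-k. *)
pose e (k : nat) : R := 4^-1 ^+ k / 8.
have e0 k : 0 < e k by rewrite divr_gt0// exprn_gt0.
have /choice[N' hN'] : forall k, exists N, D - e k <= d N.
  move=> k; have [_ [N _ <-] hN] := sup_adherent (e0 k) (conj dne dub).
  by exists N; exact: ltW.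
pose N k := maxn k (N' k).
have hN k : D - e k <= d (N k) by apply: (le_trans (hN' k)); apply: dd; exact: leq_maxr.
have /choice[v hv] : forall k, exists v, H (N k) v /\ nrm2 (pr v) <= D + e k.
  move=> k; have [_ [v Hv <-] h] := inf_adherent (e0 k) (conj (Qne (N k)) (Qlb (N k))).
  by exists v; split => //; apply: (le_trans (ltW h)); rewrite lerD2r; exact: dD.
exists N, v; split => [k|k|k]; [exact: leq_maxl|by have [] := hv k|].
have [Hv1 q1] := hv k; have [Hv2 q2] := hv k.+1.
(* At the smaller index one set [H j] contains both elements, hence their midpoint. *)
pose j := minn (N k) (N k.+1).
have [c Hc cE] := Hmid (Hdec (geq_minr (N k) (N k.+1)) Hv2) (Hdec (geq_minl (N k) (N k.+1)) Hv1).
rewrite nrm2_parallelogram; last 2 first.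
- by move=> l; apply: bmeas_pr; exact: H0 Hv2.
- by move=> l; apply: bmeas_pr; exact: H0 Hv1.
have -> : (fun s => 2^-1 *: (pr (v k.+1) s + pr (v k) s)) = pr c by apply/funext.
have ek : e k.+1 <= e k.
  by rewrite /e ler_pM2r// exprS ler_piMl ?exprn_ge0// invf_le1// ler1n.
have hj : D - e k <= d j.
  rewrite /j /minn; case: ifP => _; first exact: hN.
  by apply: le_trans (hN k.+1); rewrite lerD2l lerN2.
have := dk _ _ Hc; have eE : 8 * e k = 4^-1 ^+ k by rewrite /e mulrC divfK.
rewrite -eE; move: hj q1 q2 ek; rewrite -/j; lra.
Qed.

Lemma Int_EFin (f : R -> R) : bmeas f -> (Int f T)%:E = (\int[mu]_(s in `[0%R, T]) (f s)%:E)%E.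
Proof. by move=> bf; rewrite /Int /Rintegral fineK//; exact: integrable_fin_num (bmeas_integrable _ _ bf). Qed.

(** Squared norms of size 4^-k make the integral of each coordinate increment at most (1 + T) 2^-k.
    The sum of the absolute increments is then integrable, hence finite almost everywhere, and the
    increments telescope. *)
Lemma means_converge : exists N : nat -> nat, exists v : nat -> W,
  [/\ forall k, (k <= N k)%N, forall k, H (N k) (v k) &
    {ae mu, forall s, 0 <= s <= T -> forall l, cvgn (fun k => pr (v k) s l 0)}].
Proof.
have [N [v [kN Hv hv]]] := minimizing_sequence; exists N, v; split => //.
have H0 k : H 0 (v k) by apply: Hdec (Hv k).
pose f l k s := `|pr (v k.+1) s l 0 - pr (v k) s l 0|.
have bf l k : bmeas (f l k).
  have [mf [B hB]] := bmeasB (bmeas_pr l (H0 k.+1)) (bmeas_pr l (H0 k)).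
  split; first exact: measurableT_comp.
  by exists B => s; rewrite /f normr_id.
have Intf l k : Int (f l k) T <= (1 + T) * 2^-1 ^+ k.
  have bfl j : bmeas (fun s => (pr (v k.+1) s - pr (v k) s) j 0).
    by under eq_fun do rewrite !mxE; apply: bmeasB; exact: bmeas_pr.
  have p0 : 0 < (2 : R) ^+ k by rewrite exprn_gt0.
  (* From a <= p a^2 + 1/p with p = 2^k: after integration both terms are of order 2^-k. *)
  apply: (@le_trans _ _ (Int (fun s => 2 ^+ k * \sum_j ((pr (v k.+1) s - pr (v k) s) j 0) ^+ 2 + 2^-1 ^+ k) T)).
    apply: le_Int => //.
      by apply: bmeasD; [apply: bmeasZ; exact: bmeas_sumsq|exact: bmeas_cst].
    move=> s _.
    apply: (@le_trans _ _ (2 ^+ k * (f l k s) ^+ 2 + 2^-1 ^+ k)).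
      (* AM-GM *)
      rewrite exprVn; set p := 2 ^+ k in p0 *; set a := f l k s.
      rewrite -subr_ge0.
      have -> : p * a ^+ 2 + p^-1 - a = ((p * a) ^+ 2 + 1 - p * a) / p.
        by field; rewrite gt_eqF.
      rewrite divr_ge0 ?(ltW p0)//.
      by have := sqr_ge0 (p * a - 1); have := sqr_ge0 (p * a); rewrite sqrrB1; lra.
    rewrite lerD2r ler_pM2l// (bigD1 l)//= /f real_normK ?num_real// !mxE lerDl.
    by apply: sumr_ge0 => j _; exact: sqr_ge0.
  rewrite IntD; [|by apply: bmeasZ; exact: bmeas_sumsq|exact: bmeas_cst].
  rewrite Int_cst// IntZ; last exact: bmeas_sumsq.
  rewrite mulrDl mul1r (mulrC T) lerD2r.
  have := hv k; rewrite /nrm2 -(ler_pM2l p0) => /le_trans; apply.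
  have -> : (4^-1 : R) = 2^-1 * 2^-1 by rewrite -invfM -natrM.
  by rewrite exprMn mulrA exprVn divff ?mul1r// gt_eqF.
have aef l : {ae mu, forall s, 0 <= s <= T -> (\sum_(0 <= k <oo) (f l k s)%:E < +oo)%E}.
  have mf k : measurable_fun `[0, T] (EFin \o f l k).
    by apply/measurable_EFinP/measurable_funTS; case: (bf l k).
  have f0 k s : (0 <= (EFin \o f l k) s)%E by rewrite lee_fin; exact: normr_ge0.
  have Is : (\int[mu]_(s in `[0%R, T]) (\sum_(0 <= k <oo) (EFin \o f l k) s) < +oo)%E.
    rewrite integral_nneseries//.
    apply: (@le_lt_trans _ _ (2 * (1 + T))%:E); last exact: ltry.
    apply: lime_le; first by apply: is_cvg_nneseries => k _ _; exact: integral_ge0.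
    apply: nearW => K.
    under eq_bigr do rewrite -Int_EFin//.
    rewrite sumEFin lee_fin.
    (* The remainder of the geometric series is kept so that the induction closes. *)
    suff : \sum_(0 <= k < K) Int (f l k) T <= 2 * (1 + T) - 2 * (1 + T) * 2^-1 ^+ K.
      move=> /le_trans; apply; rewrite gerBl mulr_ge0 ?exprn_ge0// mulr_ge0// addr_ge0//.
    elim: K => [|K IH]; first by rewrite big_geq// expr0 mulr1 subrr.
    rewrite big_nat_recr//=; have := Intf l K; rewrite exprS; lra.
  have iF : mu.-integrable `[0, T] (fun s => \sum_(0 <= k <oo) (EFin \o f l k) s)%E.
    apply/integrableP; split.
      exact: (@ge0_emeasurable_sum _ _ R `[0, T]%classic (fun k => EFin \o f l k) xpredT (fun k s _ _ => f0 k s) (fun k _ => mf k)).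
    under eq_integral do (rewrite gee0_abs; last by apply: nneseries_ge0 => ? ? ?; exact: f0).
    exact: Is.
  have h : {ae mu, forall s, `[0, T]%classic s ->
      (\sum_(0 <= k <oo) (EFin \o f l k) s)%E \is a fin_num}.
    by apply: integrable_ae iF.
  apply: ae_imp h => s hs sT; have := hs; rewrite /= in_itv/= => /(_ sT).
  by rewrite ge0_fin_numE// nneseries_ge0// => k _ _; exact: f0.
apply: ae_imp (ae_forall_ord aef) => s hs sT l.
have f0 k : (0 <= (f l k s)%:E)%E by rewrite lee_fin; exact: normr_ge0.
have Sfin : (\sum_(0 <= k <oo) (f l k s)%:E)%E \is a fin_num.
  by rewrite ge0_fin_numE ?hs// nneseries_ge0.
pose a k := pr (v k) s l 0.
have cs : cvgn (series (fun k => a k.+1 - a k)).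
  apply: normed_cvg; apply: nondecreasing_is_cvgn.
    by apply: nondecreasing_series => // k *; exact: normr_ge0.
  exists (fine (\sum_(0 <= k <oo) (f l k s)%:E)%E) => _ [K _ <-].
  rewrite -lee_fin fineK// /series/= -sumEFin.
  exact: (nneseries_lim_ge K (P := xpredT)).
have aE : (fun k => pr (v k) s l 0) = (fun k => series (fun k => a k.+1 - a k) k + a 0).
  by apply/funext => k; rewrite /series/= telescope_sumr// subrK.
by rewrite aE; apply: is_cvgD => //; exact: is_cvg_cst.
Qed.

End convergence_of_means.

(** * Borel and Lebesgue measurability *)

Section Lebesgue_sigma_algebra.
Context {R : realType}.
Notation mu := (@lebesgue_measure R).
Notation lam := (@completed_lebesgue_measure R).

Lemma borel_leb (A : set R) : measurable A -> leb_measurable A.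
Proof. exact: sub_caratheodory. Qed.

Lemma lebE (A : set R) : leb_measurable A ->
  exists2 B, measurable B & exists2 N, mu.-negligible N & A = B `|` N.
Proof.
rewrite /leb_measurable => mA.
have : (completed_algebra_gen mu).-sigma.-measurable A.
  by rewrite completed_caratheodory_measurable.
rewrite g_sigma_completed_algebra_genE => -[B mB [N nN] <-].
by exists B => //; exists N.
Qed.

Lemma ae_leb (P Q : R -> Prop) : (forall s, P s -> Q s) -> {ae mu, forall s, P s} ->
  {ae lam, forall s : LebT R, Q s}.
Proof.
move=> PQ [N [mN N0 hN]]; exists N; split=> //; first exact: borel_leb.
by move=> s /= nQ; apply: hN => /= /PQ.
Qed.

Lemma negligible_borel (N : set R) : mu.-negligible N ->
  exists2 B, measurable B & mu B = 0 /\ N `<=` B.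
Proof. by move=> [B [mB B0 NB]]; exists B. Qed.

(** For each rational, the set where [f] exceeds it is Borel up to a negligible part; one Borel null
    set [N] contains these countably many parts. *)
Lemma leb_measurable_borel_ae (f : R -> R) (I : set R) : measurable I ->
  measurable_fun (I : set (LebT R)) (f : LebT R -> R) ->
  exists N, [/\ measurable N, mu N = 0 & measurable_fun (I `\` N) f].
Proof.
move=> mI mf.
pose E (q : rat) := I `&` f @^-1` `]ratr q, +oo[.
have /choice[BN hBN] : forall q, exists BN : set R * set R,
    [/\ measurable BN.1, mu.-negligible BN.2 & E q = BN.1 `|` BN.2].
  move=> q; have : leb_measurable (E q).
    by apply: mf; [exact: borel_leb|exact: measurable_itv].
  by move=> /lebE[B mB [N nN EBN]]; exists (B, N).
have : mu.-negligible (\bigcup_k (fun k => if @unpickle rat k is Some q then (BN q).2 else set0) k).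
  apply: negligible_bigcup => k; case: unpickle => [q|]; last exact: negligible_set0.
  by have [] := hBN q.
move=> /negligible_borel[N mN [N0 hN]]; exists N; split => //.
have NBN q : (BN q).2 `<=` N.
  have qE : unpickle (pickle q) = Some q by exact: pickleK.
  by move=> s qs; apply: hN; exists (pickle q); rewrite ?qE.
move=> mIN; apply: (measurability _ (RGenOInfty.measurableE R)) => //.
move=> _ [_ [a ->] <-].
(* [f] exceeds [a] exactly when it exceeds some rational above [a]. *)
rewrite (_ : _ `&` _ = \bigcup_(q : rat) (if a < ratr q then (I `\` N) `&` (BN q).1 else set0)); last first.
  apply/seteqP; split => s /=.
    move=> [[Is Ns]]; rewrite in_itv/= andbT => as_.
    have [q] := rat_in_itvoo as_; rewrite in_itv/= => /andP[aq qs].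
    exists q => //; rewrite aq; split => //.
    have [_ _ EBN] := hBN q.
    have : E q s by split => //=; rewrite in_itv/= qs.
    by rewrite EBN => -[//|/NBN].
  move=> [q _]; case: ifP => // aq [[Is Ns] Bs]; split => //.
  have [_ _ EBN] := hBN q.
  have : E q s by rewrite EBN; left.
  by move=> [_ /=]; rewrite !in_itv/= !andbT; exact: lt_trans.
apply: bigcupT_measurable_rat => q; case: ifP => // _.
by apply: measurableI => //; have [] := hBN q.
Qed.

Lemma measurable_fun_sublevel d (X : measurableType d) (D : set X) (f : X -> R) :
  measurable D -> (forall a, measurable (D `&` [set x | f x <= a])) -> measurable_fun D f.
Proof.
move=> mD h _; apply: (measurability _ (RGenOInfty.measurableE R)) => //.
move=> _ [_ [a ->] <-].
rewrite (_ : _ `&` _ = D `\` (D `&` [set x | f x <= a])); first exact: measurableD.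
apply/seteqP; split=> x /=; rewrite in_itv/= andbT ltNge.
  by move=> [Dx /negP nfa]; split => // -[].
by move=> [Dx nfa]; split => //; apply/negP => fa; exact: nfa.
Qed.

Lemma rat_approx (z e : R) : 0 < e -> exists q : rat, `|z - ratr q| < e.
Proof.
move=> e0; have [|q] := @rat_in_itvoo R (z - e) (z + e); first by lra.
by rewrite in_itv/= => /andP[h1 h2]; exists q; rewrite ltr_norml; apply/andP; split; lra.
Qed.

(** An open set is the union of the rational boxes it contains; these are countably many, and each
    imposes finitely many conditions on coordinates. A half-width below r / 2 keeps a box around the
    point inside the ball of radius r. *)
Lemma measurable_preimage_open d (X : measurableType d) (D : set X) n m
    (x : X -> 'cV[R]_n) (u : X -> 'cV[R]_m) (O : set ('cV[R]_n * 'cV[R]_m)) :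
  measurable D -> (forall i, measurable_fun D (fun t => x t i 0)) ->
  (forall l, measurable_fun D (fun t => u t l 0)) -> open O ->
  measurable (D `&` [set t | O (x t, u t)]).
Proof.
move=> mD mx mu_ oO.
pose e (k : nat) : R := k.+1%:R^-1.
have e0 k : 0 < e k by rewrite invr_gt0.
pose box (c : 'cV[rat]_n * 'cV[rat]_m * nat) : set ('cV[R]_n * 'cV[R]_m) :=
  [set p : 'cV[R]_n * 'cV[R]_m | (forall i, `|p.1 i 0 - ratr (c.1.1 i 0)| < e c.2) /\
           (forall l, `|p.2 l 0 - ratr (c.1.2 l 0)| < e c.2)].
have mbox c : measurable (D `&` [set t | box c (x t, u t)]).
  have mcoord p (z : X -> 'cV[R]_p) (b : 'cV[rat]_p) k :
      (forall i, measurable_fun D (fun t => z t i 0)) ->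
      measurable (D `&` [set t | forall i, `|z t i 0 - ratr (b i 0)| < e k]).
    move=> mz.
    rewrite (_ : _ `&` _ = D `&` \bigcap_(i in [set: 'I_p]) (D `&` [set t | `|z t i 0 - ratr (b i 0)| < e k])); last first.
      apply/seteqP; split => t /= [Dt h]; split => //.
        by move=> i _; split => //; exact: h.
      by move=> i; have [] := h i Logic.I.
    apply: measurableI => //; apply: fin_bigcap_measurable => // i _.
    rewrite (_ : [set t | _] = (fun t => `|z t i 0 - ratr (b i 0)|) @^-1` `]-oo, e k[); last first.
      by apply/seteqP; split => t /=; rewrite in_itv.
    have : measurable_fun D (fun t => `|z t i 0 - ratr (b i 0)|).
      by apply: measurableT_comp => //; apply: measurable_funB.
    by apply => //; exact: measurable_itv.
  rewrite (_ : _ `&` _ = (D `&` [set t | forall i, `|x t i 0 - ratr (c.1.1 i 0)| < e c.2]) `&`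
    (D `&` [set t | forall l, `|u t l 0 - ratr (c.1.2 l 0)| < e c.2])).
    by apply: measurableI; exact: mcoord.
  apply/seteqP; split => t /=; first by move=> [Dt [h1 h2]].
  by move=> [[Dt h1] [_ h2]].
rewrite (_ : _ `&` _ = \bigcup_c (if `[< box c `<=` O >] then D `&` [set t | box c (x t, u t)] else set0)); last first.
  apply/seteqP; split => t /=; last first.
    by move=> [c _]; case: asboolP => // cO [Dt /cO].
  move=> [Dt Ot].
  have /nbhs_ballP[r /= r0 rO] : nbhs (x t, u t) O by apply: open_nbhs_nbhs.
  have [k hk] : exists k, e k < r / 2.
    have r2 : 0 < r / 2 by rewrite divr_gt0.
    have /cvgrPdist_lt/(_ _ r2)[k _ /(_ k (leqnn _))] := @cvg_harmonic R.
    rewrite sub0r normrN /= ger0_norm ?invr_ge0// => hk; by exists k.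
  have approx p (z : 'cV[R]_p) : exists q : 'cV[rat]_p, forall i, `|z i 0 - ratr (q i 0)| < e k.
    have hq : forall i, exists q : rat, `|z i 0 - ratr q| < e k by move=> i; exact: rat_approx.
    have [q qP] := choice hq.
    by exists (\col_i q i) => i; rewrite mxE.
  have [a ha] := approx _ (x t); have [b hb] := approx _ (u t).
  exists (a, b, k) => //; case: asboolP => // nO; exfalso; apply: nO => -[y w] [/= hy hw].
  have near p (z z' : 'cV[R]_p) (q : 'cV[rat]_p) : (forall i, `|z i 0 - ratr (q i 0)| < e k) ->
      (forall i, `|z' i 0 - ratr (q i 0)| < e k) -> ball z r z'.
    move=> hz hz'; rewrite -ball_normE /ball_/=; apply: (@le_lt_trans _ _ (e k + e k)); last by have := hk; lra.
    apply: colv_le_norm => [|i]; first by rewrite addr_ge0 ?ltW.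
    rewrite !mxE -(subrKA (ratr (q i 0))) (le_trans (ler_normD _ _))// lerD ?ltW//.
    by rewrite distrC.
  by apply: rO; split => /=; [exact: near ha hy|exact: near hb hw].
apply: countable_bigcupT_measurable; first exact: countableP.
by move=> c; case: asboolP.
Qed.

(** A good-sets argument in two layers: sets with measurable preimage under [h] form a
    sigma-algebra. It contains the rectangles because the same argument, run on the Borel factor,
    starts from open sets. *)
Lemma integrand_measurable n m (T : R) (j : R -> 'cV[R]_n -> 'cV[R]_m -> R)
    (x : R -> 'cV[R]_n) (u : R -> 'cV[R]_m) :
  normal_integrand T j ->
  (forall i, measurable_fun (`[0, T]%classic : set (LebT R)) (fun t : LebT R => x t i 0)) ->
  (forall l, measurable_fun (`[0, T]%classic : set (LebT R)) (fun t : LebT R => u t l 0)) ->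
  measurable_fun (`[0, T]%classic : set (LebT R)) (fun t : LebT R => j t (x t) (u t)).
Proof.
move=> [jm _] mx mu_.
have mI : @measurable _ (LebT R) (`[0, T]%classic : set (LebT R)).
  by apply: borel_leb; exact: measurable_itv.
apply: measurable_fun_sublevel => // a.
have setIC_D (X : Type) (D A : set X) : D `&` ~` A = D `\` (D `&` A).
  by rewrite setDE setCI setIUr setICr set0U.
pose h (t : LebT R) : R * ('cV[R]_n * 'cV[R]_m) := (t, (x t, u t)).
pose h2 (t : LebT R) : 'cV[R]_n * 'cV[R]_m := (x t, u t).
pose D : set (LebT R) := `[0, T]%classic.
have key C : leb_borel_set C -> @measurable _ (LebT R) (D `&` h @^-1` C).
  move: C; apply: smallest_sub.
    split => [|C mC|F mF].
    - by rewrite preimage_set0 setI0.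
    - by rewrite setTD preimage_setC setIC_D; exact: measurableD.
    - by rewrite preimage_bigcup setI_bigcupr; exact: bigcupT_measurable.
  move=> _ [A [B [mA mB ->]]].
  have mB' : @measurable _ (LebT R) (D `&` h2 @^-1` B).
    move: B mB; apply: smallest_sub.
      split => [|C mC|F mF].
      - by rewrite preimage_set0 setI0.
      - by rewrite setTD preimage_setC setIC_D; exact: measurableD.
      - by rewrite preimage_bigcup setI_bigcupr; exact: bigcupT_measurable.
    by move=> O oO; exact: measurable_preimage_open.
  rewrite (_ : _ `&` _ = A `&` (D `&` h2 @^-1` B)); first exact: measurableI.
  apply/seteqP; split => t /=; first by move=> [It []].
  by move=> [At [It Bt]].
have := key _ (jm a); congr (measurable _).
apply/seteqP; split => t /=; first by move=> [It []].
by move=> [It ja].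
Qed.

End Lebesgue_sigma_algebra.

Section convexity.
Context {R : realType}.

Lemma half_i01 : exists t : {i01 R}, t%:num = 2^-1 :> R.
Proof.
have h : (0 <= (2^-1 : R) <= 1) by rewrite invr_ge0 ler0n invf_le1// ler1n.
by have /andP[h0 h1] := h; exists (Itv01 h0 h1).
Qed.

Lemma convex_set_midpoint m (U : set 'cV[R]_m) v w : convex_set U ->
  U v -> U w -> U (2^-1 *: (v + w)).
Proof.
move=> cU Uv Uw; have [t tE] := half_i01.
have := cU v w t; rewrite !inE => /(_ Uv Uw).
rewrite /conv/= tE /unstable.onem (_ : 1 - 2^-1 = 2^-1 :> R); last by lra.
by rewrite -scalerDr.
Qed.

Lemma convex_function_midpoint m (f : 'cV[R]_m -> R) v w : convex_function setT f ->
  f (2^-1 *: (v + w)) <= 2^-1 * (f v + f w).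
Proof.
move=> cf; have [t tE] := half_i01.
have := cf t v w; rewrite !inE => /(_ I I).
rewrite convRE /conv/= tE /unstable.onem (_ : 1 - 2^-1 = 2^-1 :> R); last by lra.
by rewrite -scalerDr mulrDr.
Qed.

End convexity.

Section uniform_in_control.
Context {R : realType}.

(** Joint continuity bounds the partial derivatives near (x, w), and compactness of [U] makes the
    neighbourhood and the bound uniform in [w]; the mean value theorem on the segment from [x] to
    [y] concludes. *)
Lemma near_le_compact n m (g : 'cV[R]_n -> 'cV[R]_m -> R) (U : set 'cV[R]_m) x e :
  compact U -> (forall y w, differentiable (g ^~ w) y) ->
  (forall v : 'cV[R]_n, continuous (fun p : 'cV[R]_n * 'cV[R]_m => 'D_v (g ^~ p.2) p.1)) ->
  0 < e -> exists2 d, 0 < d & forall y w, `|y - x| < d -> U w -> g x w <= g y w + e.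
Proof.
move=> cU dg cD e0.
(* The single parameter [d] is the radius and, through its inverse, the bound on the derivative, so
   one limit governs both. *)
have bnd (i : 'I_n) : \forall d \near 0^'+, U `<=` [set w | forall y, `|y - x| < d ->
    `|'D_(delta_mx i 0) (g ^~ w) y| <= d^-1].
  have /compact_near_coveringP/(_ _ (0^'+) (fun d w => forall y, `|y - x| < d ->
    `|'D_(delta_mx i 0) (g ^~ w) y| <= d^-1)) := cU.
  apply => w Uw.
  have cw := cD (delta_mx i 0) (x, w).
  have /cvgrPdist_lt/(_ _ ltr01)[[A B] /= [xA wB] AB] := cw.
  have /nbhs_ballP[r /= r0 rA] := xA.
  set D0 := `|'D_(delta_mx i 0) (g ^~ w) x|.
  have D00 : 0 <= D0 by exact: normr_ge0.
  exists (B, [set d | 0 < d /\ d < r /\ d < (1 + D0)^-1]) => /=.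
    split => //=.
    have D1 : 0 < (1 + D0)^-1 by rewrite invr_gt0 ltr_wpDr.
    by near=> d; split => //; split; near: d; exact: nbhs_right_lt.
  move=> [w' d] /= [Bw' [d0 [dr dD]]] y yx.
  have := AB (y, w') => /= /(_ _)/ltW; set D' := 'D_(delta_mx i 0) (g ^~ w') y.
  move=> h; have : `|D'| <= 1 + D0.
    rewrite -lerBlDr; apply: le_trans (h _); last first.
      split => //; apply: rA; rewrite -ball_normE /ball_/= distrC.
      exact: lt_trans yx dr.
    by rewrite distrC; exact: lerB_dist.
  have D1 : 0 < (1 + D0)^-1 by rewrite invr_gt0 ltr_wpDr.
  by move=> /le_trans; apply; rewrite -[leLHS]invrK lef_pV2 ?posrE// ltW.
have [d [d0 hd]] : exists d, 0 < d /\ forall i : 'I_n, U `<=` [set w | forall y, `|y - x| < d ->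
    `|'D_(delta_mx i 0) (g ^~ w) y| <= d^-1].
  have : \forall d \near 0^'+, 0 < d /\ forall i : 'I_n, U `<=` [set w | forall y, `|y - x| < d ->
    `|'D_(delta_mx i 0) (g ^~ w) y| <= d^-1].
    near=> d; split=> //; near: d; exact: filter_forall.
  by move=> /filter_ex.
pose K := n%:R * d^-1.
have lip_const_ge0 : 0 <= K by rewrite mulr_ge0// invr_ge0 ltW.
(* [K] adds up the [n] bounds on partial derivatives, so the increment is at most [K] times the norm
   of [y - x]; the added 1 avoids dividing by 0. *)
exists (Num.min d (e / (K + 1))); first by rewrite lt_min d0 divr_gt0// ltr_wpDl.
move=> y w; rewrite lt_min => /andP[yd ye] Uw.
pose v := y - x; pose h (r : R) := g (x + r *: v) w.
have dh (r : R) : is_derive r (1 : R) h ('D_v (g ^~ w) (x + r *: v)).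
  have dv := diff_derivable (v := v) (dg (x + r *: v) w).
  have E : (fun k : R => k^-1 *: ((h \o shift r) (k *: (1 : R)) - h r)) =
      (fun k : R => k^-1 *: (((g ^~ w) \o shift (x + r *: v)) (k *: v) - g (x + r *: v) w)).
    apply/funext => k; rewrite /h /=; congr (_ *: (g _ _ - _)).
    by rewrite [k *: 1]mulr1 scalerDl addrCA.
  by apply: DeriveDef; [rewrite /derivable E|rewrite /derive E].
have ch : {within `[0, 1], continuous h}.
  apply: continuous_subspaceT => r.
  by apply: differentiable_continuous; apply/derivable1_diffP; case: (dh r).
have [c] := MVT ltr01 (fun r _ => dh r) ch.
rewrite in_itv/= => /andP[c0 c1].
rewrite subr0 mulr1 /h scale1r scale0r addr0 /v [x + _]addrC subrK -/v => gE.
suff : `|'D_v (g ^~ w) (x + c *: v)| <= e.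
  by rewrite -gE ler_norml => /andP[+ _]; lra.
have xc : `|x + c *: v - x| < d.
  rewrite addrC addKr normrZ ger0_norm ?ltW//; apply: le_lt_trans yd.
  by rewrite ler_piMl// ltW.
move: (x + c *: v) xc {gE} => a xc; rewrite deriveE//.
have vE : v = \sum_i v i 0 *: delta_mx i 0.
  by rewrite {1}(matrix_sum_delta v); apply: eq_bigr => i _; rewrite big_ord1.
rewrite vE linear_sum/=; apply: (le_trans (ler_norm_sum _ _ _)).
apply: (@le_trans _ _ (\sum_(i < n) `|v| * d^-1)).
  apply: ler_sum => i _; rewrite linearZ/= normrM; apply: ler_pM => //.
    exact: entry_le_norm.
  by rewrite -deriveE//; exact: hd.
rewrite sumr_const card_ord -mulr_natl mulrCA -/K.
apply: (@le_trans _ _ (e / (K + 1) * (K + 1))); last by rewrite divfK// gt_eqF// ltr_wpDl.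
by apply: ler_pM => //; [exact: ltW|rewrite lerDl].
Unshelve. all: by end_near.
Qed.

End uniform_in_control.

Section ereal_liminf.
Context {R : realType}.
Local Open Scope ereal_scope.

Lemma limn_einf_ge (u : nat -> \bar R) (c : R) :
  (forall e : R, (0 < e)%R -> \forall k \near \oo, (c - e)%:E <= u k) -> c%:E <= limn_einf u.
Proof.
move=> h; apply/lee_addgt0Pr => e e0.
have [N _ hN] := h e e0.
rewrite limn_einf_lim -leeBlDr// -EFinB; apply: lime_ge; first exact: is_cvg_einfs.
exists N => // k /= Nk; apply: le_ereal_inf_tmp => _ [l /= kl <-].
by apply: hN => /=; exact: leq_trans Nk kl.
Qed.

Lemma limn_einf_le (u : nat -> \bar R) (c : R) :
  (forall e : R, (0 < e)%R -> exists N, forall k, (N <= k)%N -> u k <= (c + e)%:E) ->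
  limn_einf u <= c%:E.
Proof.
move=> h; apply/lee_addgt0Pr => e e0.
have [N hN] := h e e0.
rewrite limn_einf_lim -EFinD; apply: lime_le; first exact: is_cvg_einfs.
exists N => // k /= Nk; apply: le_trans (hN k Nk).
by apply: ereal_inf_lbound; exists k => /=.
Qed.

End ereal_liminf.

(** * Integral bounds under averaging and under lower limits *)

Section integral_inequalities.
Context d {X : measurableType d} {R : realType} (nu : {measure set X -> \bar R}) (D : set X)
  (mD : measurable D).

Lemma integral_midpoint_le (f g : X -> R) (b : R) :
  measurable_fun D f -> measurable_fun D g ->
  (forall t, D t -> 0 <= f t) -> (forall t, D t -> 0 <= g t) ->
  (\int[nu]_(t in D) (f t)%:E <= b%:E)%E -> (\int[nu]_(t in D) (g t)%:E <= b%:E)%E ->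
  (\int[nu]_(t in D) (2^-1 * (f t + g t))%:E <= b%:E)%E.
Proof.
move=> mf mg f0 g0 fb gb.
have mf' : measurable_fun D (EFin \o f) by exact/measurable_EFinP.
have mg' : measurable_fun D (EFin \o g) by exact/measurable_EFinP.
have -> : (\int[nu]_(t in D) (2^-1 * (f t + g t))%:E =
    2^-1%:E * \int[nu]_(t in D) ((f t)%:E + (g t)%:E))%E.
  rewrite -ge0_integralZl_EFin//.
    by move=> t Dt; rewrite adde_ge0 ?lee_fin ?f0 ?g0.
  exact: emeasurable_funD.
rewrite ge0_integralD//.
have -> : b%:E = (2^-1%:E * (b%:E + b%:E))%E.
  by rewrite -EFinD -EFinM; congr (_%:E); field.
by rewrite lee_wpmul2l ?lee_fin// leeD.
Qed.

Lemma fatou_le (f : X -> R) (g : nat -> X -> R) (a : R) :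
  measurable_fun D f -> (forall k, measurable_fun D (g k)) ->
  (forall t, D t -> 0 <= f t) -> (forall k t, D t -> 0 <= g k t) ->
  {ae nu, forall t, D t -> forall eps, 0 < eps -> \forall k \near \oo, f t - eps <= g k t} ->
  (forall eps, 0 < eps -> exists N, forall k, (N <= k)%N ->
     (\int[nu]_(t in D) (g k t)%:E <= (a + eps)%:E)%E) ->
  (\int[nu]_(t in D) (f t)%:E <= a%:E)%E.
Proof.
move=> mf mg f0 g0 fg ga.
have mg' k : measurable_fun D (EFin \o g k) by exact/measurable_EFinP.
apply: (@le_trans _ _ (\int[nu]_(t in D) limn_einf (fun k => (g k t)%:E))%E).
  apply: ae_ge0_le_integral => //.
  - exact/measurable_EFinP.
  - move=> t Dt; apply: limn_einf_ge => eps eps0; apply: nearW => k.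
    by rewrite lee_fin sub0r (le_trans _ (g0 k t Dt))// oppr_le0 ltW.
  - apply: (@emeasurable_fun_cvg _ _ _ _ (fun k t => einfs (fun i => (g i t)%:E) k)).
      by move=> k; exact: measurable_fun_einfs.
    by move=> t _; rewrite limn_einf_lim; exact: is_cvg_einfs.
  move: fg => [N [mN N0 hN]]; exists N; split => // t /= h; apply: hN => /= h'; apply: h => Dt.
  apply: limn_einf_ge => eps eps0; apply: filterS (h' Dt eps eps0) => k.
  by rewrite lee_fin.
apply: (@le_trans _ _ (limn_einf (fun k => \int[nu]_(t in D) (g k t)%:E)%E)).
  by apply: fatou => // k t Dt; rewrite lee_fin g0.
exact: limn_einf_le.
Qed.

End integral_inequalities.

Section patched_controls.
Context {R : realType} {m : nat} (U : set 'cV[R]_m).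

(** The default [u0], taken in [U], restores membership in [U] outside [E]. *)
Definition patched (E : set R) (u : R -> 'cV[R]_m) u0 s := if `[< E s >] then u s else u0.

Lemma ctrl_patched (E : set R) (u : R -> 'cV[R]_m) u0 : measurable E ->
  (forall l, measurable_fun E (fun s => u s l 0)) -> (forall s, E s -> U (u s)) -> U u0 ->
  ctrl U (patched E u u0).
Proof.
move=> mE mu_ Uu Uu0; split => [l|s]; last by rewrite /patched; case: asboolP => // /Uu.
rewrite -(setUv E); apply/measurable_funU => //; first exact: measurableC.
split.
  apply: eq_measurable_fun (mu_ l) => s; rewrite inE => Es.
  by rewrite /patched asboolT.
apply: (eq_measurable_fun (fun=> u0 l 0)); last exact: measurable_cst.
by move=> s; rewrite inE => /= nEs; rewrite /patched asboolF.
Qed.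

End patched_controls.

(* Iterated midpoints of the tail from k; the running cost is averaged along with
   the control. *)
Inductive midhull {R : realType} {m : nat} (gen : nat -> (R -> 'cV[R]_m) * (R -> R)) (k : nat) :
    (R -> 'cV[R]_m) * (R -> R) -> Prop :=
| midhull_gen i : (k <= i)%N -> midhull gen k (gen i)
| midhull_mid p q : midhull gen k p -> midhull gen k q ->
    midhull gen k (fun s => 2^-1 *: (p.1 s + q.1 s), fun s => 2^-1 * (p.2 s + q.2 s)).

Lemma midhull_dec (R : realType) m (gen : nat -> (R -> 'cV[R]_m) * (R -> R)) k l :
  (k <= l)%N -> midhull gen l `<=` midhull gen k.
Proof.
move=> kl p; elim=> [i li|q r _ hq _ hr]; last exact: midhull_mid.
by apply: midhull_gen; exact: leq_trans li.
Qed.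

(** * The limit pair and its optimality *)

Section control_problem.
Context {R : realType} {n m : nat} (T tau : R)
  (F0 : 'cV[R]_n -> 'cV[R]_n -> 'cV[R]_n)
  (F1 : 'cV[R]_n -> 'cV[R]_n -> 'M[R]_(n, m))
  (phi : R -> 'cV[R]_n) (U : set 'cV[R]_m)
  (j : R -> 'cV[R]_n -> 'cV[R]_m -> R) (L M : R)
  (L0 : 0 <= L) (F0L : lip2 F0 L) (F1L : lip2 F1 L) (M0 : 0 <= M)
  (UM : forall w, U w -> `|w| <= M) (tau0 : 0 <= tau) (T0 : 0 <= T)
  (cphi : {within [set` `[- tau, 0]], continuous phi}).
Notation mu := (@lebesgue_measure R).
Notation lam := (@completed_lebesgue_measure R).
Implicit Types (x y : R -> 'cV[R]_n) (u v : R -> 'cV[R]_m).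
Local Notation field := (rhs tau F0 F1).
Local Notation K := (@lip_const R m L M).
Local Notation A := (growth_const F0 F1 M).
Local Notation istate := (istate T tau F0 F1 phi).

Lemma istate_lip u x C : ctrl U u -> istate u x -> (forall s, `|x s| <= C) ->
  forall s r, 0 <= s <= T -> 0 <= r <= T -> `|x s - x r| <= (A + K * C) * `|s - r|.
Proof.
move=> cu [tx _ xI] xC s r sI rI; apply: colv_le_norm => [|i].
  rewrite mulr_ge0// addr_ge0 ?(growth_const_ge0 F0 F1 M0)// mulr_ge0 ?(lip_const_ge0 L0 M0)//.
  exact: le_trans (xC 0).
rewrite !mxE !xI// opprD addrACA subrr add0r.
have /andP[s0 _] := sI; have /andP[r0 _] := rI.
have bf := field_bmeas F0L F1L UM tau0 i (lerN_delay tau0 T0) tx cu.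
apply: Int_lip => // q; apply: le_trans (entry_le_norm _ i 0) _.
by apply: (field_bound F0L F1L UM tau0 xC _ (cu.2 q)) => p _; exact: xC.
Qed.

(** Near an interior time each coordinate of [x] is a constant plus an integral, hence
    differentiable at almost every time; finitely many coordinates share one null set. *)
Lemma istate_assoc u x : ctrl U u -> istate u x -> assoc_state T tau F0 F1 phi u x.
Proof.
move=> cu sx; have [tx xphi xI] := sx; have [cx xE] := tx.
have [C xC] := traj_bounded (lerN_delay tau0 T0) tx.
split.
- exact: continuous_subspaceT.
- by move=> s; rewrite in_itv/=; exact: xphi.
- have h00 : ([set` `[0, T]] `*` [set` `[0, T]]) ((0, 0) : R * R).
    by split; rewrite /= in_itv/= lexx.
  apply: (@klipschitzW _ _ _ (A + K * C)); first exact: globally_properfilter h00.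
  by move=> [s r] /=; rewrite !in_itv/= => -[sI rI]; exact: (istate_lip cu sx xC sI rI).
have aeF : {ae mu, forall t, forall i, 0 < t ->
    derivable (Int (fun s => field x s (u s) i 0)) t 1 /\
    'D_1 (Int (fun s => field x s (u s) i 0)) t = field x t (u t) i 0}.
  apply: ae_forall_ord => i; apply: Int_FTC.
  exact: (field_bmeas F0L F1L UM tau0 i (lerN_delay tau0 T0) tx cu).
apply: ae_imp aeF => t ht; rewrite in_itv/= => /andP[t0 tT].
have dxi i : is_derive t (1 : R) (fun s => x s i 0) (field x t (u t) i 0).
  have [d e] := ht i t0.
  have D1 : is_derive t (1 : R) (fun s => phi 0 i 0 + Int (fun s => field x s (u s) i 0) s)
      (0 + field x t (u t) i 0).
    by apply: is_deriveD; exact: (DeriveDef d e).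
  rewrite add0r in D1; apply: near_eq_is_derive D1.
  near=> s; rewrite xI//; apply/andP; split; apply: ltW; near: s.
    exact: lt_nbhsr.
  exact: lt_nbhsl.
have dx : derivable x t 1.
  by apply/derivable_mxP => i k; rewrite ord1; case: (dxi i).
split => //; rewrite derive_mx//; apply/matrixP => i k; rewrite ord1 mxE.
by have [_ ->] := dxi i.
Unshelve. all: by end_near.
Qed.

(** A state is constrained on [- tau, T] only, so it is first extended by constants; its
    coordinates, Lipschitz on [0, T], are then recovered from their derivatives. *)
Lemma assoc_istate u v x : ctrl U v -> {ae mu, forall s, 0 <= s <= T -> u s = v s} ->
  assoc_state T tau F0 F1 phi u x -> istate v (x \o clamp (- tau) T).
Proof.
move=> cv uv [cx xphi lx hx].
set z := x \o _.
have zE s : - tau <= s <= T -> z s = x s by move=> sI; rewrite /z/= clamp_id.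
have tz : traj (- tau) T z.
  split; first exact: clamp_comp_continuous (lerN_delay tau0 T0) cx.
  by move=> s; rewrite /z/= (clamp_id (clamp_itv s (lerN_delay tau0 T0))).
have zphi s : - tau <= s <= 0 -> z s = phi s.
  move=> sI; rewrite zE; first by apply: xphi; rewrite in_itv.
  by have /andP[-> s0] := sI; exact: le_trans T0.
split => // t tI i.
have nt0 := oppr_delay_le0 tau0.
have [B zB] := traj_bounded (lerN_delay tau0 T0) tz.
(* Frozen outside [0, T]: on the history [z] is merely continuous, while [lipschitz_FTC2] asks for a
   Lipschitz function on the line. *)
pose Y s := z (clamp 0 T s) i 0.
have YB s : `|Y s| <= B by apply: le_trans (zB (clamp 0 T s)); exact: entry_le_norm.
have Iz s : 0 <= s <= T -> z s = x s.
  by move=> /andP[s0 sT]; rewrite zE// sT (le_trans nt0).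
have [D YD] : exists D, forall s r, `|Y s - Y r| <= D * `|s - r|.
  near (pinfty_nbhs R) => D; exists D => s r.
  have D0 : 0 <= D by near: D; exact: nbhs_pinfty_ge.
  apply: (@le_trans _ _ (D * `|clamp 0 T s - clamp 0 T r|)); last first.
    by rewrite ler_wpM2l// clamp_lip.
  have hD : D.-lipschitz_([set` `[0, T]]) x by near: D.
  have := hD (clamp 0 T s, clamp 0 T r) => /= /(_ _)/(le_trans _); apply; last first.
    by split; rewrite in_itv/= clamp_itv.
  rewrite /Y !Iz ?clamp_itv//; apply: le_trans (entry_le_norm _ i 0); by rewrite !mxE.
have bf := field_bmeas F0L F1L UM tau0 i (lerN_delay tau0 T0) tz cv.
have := @lipschitz_FTC2 R Y _ T D B YD YB bf _ t tI.
rewrite /Y !clamp_id// ?lexx// -zphi ?lexx ?nt0// => <-; first by rewrite addrC subrK.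
apply: ae_imp (ae_and hx uv) => s [hs us] /andP[s0 sT].
have [|dx ex] := hs; first by rewrite in_itv/= s0.
have sI : 0 <= s <= T by rewrite !ltW.
have maxE : maxd tau x s = maxd tau z s.
  apply/colP => k; rewrite !mxE; congr sup; apply/seteqP.
  have W r : s - tau <= r <= s -> - tau <= r <= T.
    by move=> /andP[r1 r2]; apply/andP; split; [apply: le_trans r1; rewrite lerDr ltW|apply: le_trans r2 (ltW sT)].
  by split=> _ [r /= rI <-]; exists r => //; rewrite zE//; apply: W; rewrite in_itv in rI.
have fE : field z s (v s) = 'D_1 x s by rewrite ex /rhs maxE Iz// -us.
have D1 : is_derive s (1 : R) (fun r => x r i 0) (field z s (v s) i 0).
  rewrite fE derive_mx// mxE; apply: DeriveDef => //.
  by move/derivable_mxP : dx; exact.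
suff : is_derive s (1 : R) Y (field z s (v s) i 0) by move=> [d e].
apply: near_eq_is_derive D1; near=> r.
have rI : 0 <= r <= T.
  apply/andP; split; apply: ltW; near: r; [exact: lt_nbhsr|exact: lt_nbhsl].
by rewrite /Y clamp_id// Iz.
Unshelve. all: by end_near.
Qed.

Context (cU : closed U) (U0 : U !=set0) (cvU : convex_set U).

(** Two null sets are cut out, one where [u] may leave [U] and one outside which all coordinates are
    Borel; a point of [U] fills the gaps. *)
Lemma ctrl_of_feasible u : feasible T U u ->
  exists2 v, ctrl U v & {ae mu, forall s, 0 <= s <= T -> u s = v s}.
Proof.
move=> [[mu_ _] [NU [mNU NU0 hNU]]].
have [u0 Uu0] := U0.
have mI : measurable (`[0, T]%classic : set R) by exact: measurable_itv.
have /choice[N hN] : forall l, exists N : set R, [/\ measurable N, mu N = 0 &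
    measurable_fun (`[0, T]%classic `\` N) (fun s => u s l 0)].
  by move=> l; exact: leb_measurable_borel_ae (mu_ l).
have aeN : {ae mu, forall s, forall l, ~ N l s}.
  apply: ae_forall_ord => l; exists (N l); have [mN N0 _] := hN l; split => //.
  by move=> s /= /contrapT.
have [NN [mNN NN0 hNN]] := aeN.
pose E := (`[0, T]%classic `\` NU) `\` NN : set R.
have EN s l : E s -> ~ N l s.
  by move=> [_ nNN] Nls; apply: nNN; apply: hNN => /= /(_ l).
exists (patched E u u0).
  apply: ctrl_patched => //.
  - by apply: measurableD => //; exact: measurableD.
  - move=> l; have [mN N0 mf] := hN l.
    apply: measurable_funS mf; first exact: measurableD.
    by move=> s Es; split; [case: Es => -[]|exact: EN].
  - by move=> s [[sI nNU] _]; apply: contrapT => nU; apply: nNU; apply: hNU => /= /(_ sI).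
have aenot (S : set R) : measurable S -> mu S = 0 -> {ae mu, forall s, ~ S s}.
  by move=> mS S0; exists S; split=> // s /= /contrapT.
apply: ae_imp (ae_and (aenot _ mNU NU0) (aenot _ mNN NN0)) => s [h1 h2] sI.
by rewrite /patched asboolT// /E; split => //; split => //; rewrite /= in_itv.
Qed.

Lemma feasible_ctrl u : ctrl U u -> feasible T U u.
Proof.
move=> [mu_ Uu]; split; last by apply: aeW => s _.
split; last by exists M; apply: aeW => s _; exact: UM.
move=> l mI Y mY; apply: borel_leb; exact: measurable_funTS (mu_ l) _ _ _.
Qed.

Context (jn : normal_integrand T j)
  (j0 : forall t (a : 'cV[R]_n) (w : 'cV[R]_m), t \in `[0, T] -> 0 <= j t a w)
  (jc : forall t (a : 'cV[R]_n), t \in `[0, T] -> convex_function setT (fun w => j t a w))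
  (jd : forall t (a : 'cV[R]_n) (w : 'cV[R]_m), t \in `[0, T] ->
     differentiable (fun b => j t b w) a)
  (jD : forall t (b : 'cV[R]_n), t \in `[0, T] ->
     continuous (fun p : 'cV[R]_n * 'cV[R]_m => 'D_b (fun a => j t a p.2) p.1))
  (kU : compact U).
Local Notation I := (`[0%R, T]%classic : set (LebT R)).

Lemma leb_itv : @measurable _ (LebT R) I.
Proof. by apply: borel_leb; exact: measurable_itv. Qed.

Lemma leb_measurable_traj x i : continuous x -> measurable_fun I (fun t : LebT R => x t i 0).
Proof.
move=> cx mI Y mY; apply: borel_leb.
have mx : measurable_fun setT (fun t => x t i 0).
  apply: continuous_measurable_fun => s.
  apply: (@continuous_comp _ _ _ x (fun a : 'cV[R]_n => a i 0)); first exact: cx.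
  exact: coord_continuous.
exact: measurable_funTS mx _ _ _.
Qed.

Lemma leb_measurable_ctrl u l : ctrl U u -> measurable_fun I (fun t : LebT R => u t l 0).
Proof. by move=> cu; have [[+ _] _] := feasible_ctrl cu; exact. Qed.

Lemma cost_eq u v x z : (forall l, measurable_fun I (fun t : LebT R => u t l 0)) -> ctrl U v ->
  continuous z -> (forall s, 0 <= s <= T -> z s = x s) ->
  {ae mu, forall s, 0 <= s <= T -> u s = v s} -> cost T j x u = cost T j z v.
Proof.
move=> mu_ cv cz zx uv; rewrite /cost.
transitivity (\int[lam]_(t in I) (j t (z t) (u t))%:E)%E.
  by apply: eq_integral => t; rewrite inE/= in_itv/= => tI; rewrite zx.
have mz i := leb_measurable_traj i cz.
apply: ge0_ae_eq_integral.
- exact: leb_itv.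
- by apply/measurable_EFinP; exact: (integrand_measurable jn mz mu_).
- apply/measurable_EFinP.
  exact: (integrand_measurable jn mz (fun l => leb_measurable_ctrl l cv)).
- by move=> t It; rewrite lee_fin; apply: j0.
- by move=> t It; rewrite lee_fin; apply: j0.
apply: (ae_leb _ uv) => t uvt It.
by rewrite uvt//; move: It; rewrite /= in_itv.
Qed.

(** Compactness and lower semicontinuity in one statement, since the limit control is built from
    averages that carry their running costs along. *)
Lemma limit_pair (us : nat -> R -> 'cV[R]_m) (xs : nat -> R -> 'cV[R]_n) (a : R) :
  (forall k, ctrl U (us k)) -> (forall k, istate (us k) (xs k)) ->
  (forall e, 0 < e -> exists N, forall k, (N <= k)%N -> (cost T j (xs k) (us k) <= (a + e)%:E)%E) ->
  exists u x, [/\ ctrl U u, istate u x & (cost T j x u <= a%:E)%E].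
Proof.
move=> cus sxs costa.
have [u0 Uu0] := U0.
have tT := lerN_delay tau0 T0.
have [C hC] := state_bounded L0 F0L F1L M0 UM tau0 T0 cphi.
have xC k s : `|xs k s| <= C by exact: hC (cus k) (sxs k) s.
have txs k : traj (- tau) T (xs k) by case: (sxs k).
have xphi k s : - tau <= s <= 0 -> xs k s = phi s by case: (sxs k) => _ + _; exact.
have xlip k s r : 0 <= s <= T -> 0 <= r <= T -> `|xs k s - xs k r| <= (A + K * C) * `|s - r|.
  exact: istate_lip (cus k) (sxs k) (xC k) s r.
have [y hy] := equilipschitz_cluster tau0 T0 txs xphi xC xlip.
pose e (k : nat) : R := k.+1%:R^-1.
have e0 k : 0 < e k by rewrite invr_gt0.
have ele k i : (k <= i)%N -> e i <= e k by move=> ki; rewrite lef_pV2 ?posrE// ler_nat ltnS.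
have esmall eps : 0 < eps -> \forall k \near \oo, e k < eps.
  move=> eps0; have /cvgrPdist_lt/(_ _ eps0) := @cvg_harmonic R.
  by apply: filterS => k; rewrite sub0r normrN /= ger0_norm ?invr_ge0.
have /choice[sg hsg] : forall k, exists i, (k <= i)%N /\ forall s, `|xs i s - y s| <= e k.
  by move=> k; have [i ki hi] := hy _ (e0 k) k; exists i.
pose z k := xs (sg k); pose w k := us (sg k).
have zy k s : `|z k s - y s| <= e k by have [_] := hsg k; exact.
have ty : traj (- tau) T y.
  by apply: (traj_lim txs) => eps eps0; have [k _ hk] := hy _ eps0 0%N; exists k.
have [cy _] := ty.
have yphi s : - tau <= s <= 0 -> y s = phi s.
  move=> sI; apply/eqP; rewrite eq_sym -subr_eq0; apply/eqP/(@le0_eps _ 'cV[R]_n _ 1) => eps eps0.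
  have [k _ hk] := hy _ eps0 0%N.
  by rewrite mul1r -(xphi k).
have cw k : ctrl U (w k) by exact: cus.
(* The running cost is taken along the state of [w i] itself, so that its integral is a cost of the
   sequence. *)
pose gen i := (w i, fun t => j t (z i t) (w i t)).
have Hctrl k p : midhull gen k p -> ctrl U p.1.
  elim=> [i _|q r _ [mq Uq] _ [mr Ur]] /=; first exact: cw.
  split=> [l|s]; last exact: convex_set_midpoint.
  under eq_fun do rewrite !mxE.
  by apply: measurable_funM => //; exact: measurable_funD.
have [|||||N [v [kN Hv aecv]]] := @means_converge R _ m (fun p => p.1) T M (midhull gen) T0.
- by move=> k; exists (gen k); exact: midhull_gen.
- by move=> k l; exact: midhull_dec.
- by move=> k p q hp hq; eexists; first exact: midhull_mid hp hq.
- by move=> p /Hctrl[].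
- by move=> p /Hctrl[_ Up] s; apply: UM.
have Hv' k : midhull gen k (v k) := midhull_dec (kN k) (Hv k).
have Hmeas k p : midhull gen k p -> measurable_fun I (p.2 : LebT R -> R).
  elim=> [i _|q r _ mq _ mr].
    have [cz _] := txs (sg i).
    exact: (integrand_measurable jn (fun l => leb_measurable_traj l cz)
      (fun l => leb_measurable_ctrl l (cw i))).
  exact: (measurable_funM (measurable_cst _) (measurable_funD mq mr)).
have Hge0 k p : midhull gen k p -> forall t, 0 <= t <= T -> 0 <= p.2 t.
  elim=> [i _|q r _ q0 _ r0] t tI /=; first by apply: j0; rewrite in_itv.
  by rewrite mulr_ge0// addr_ge0 ?q0 ?r0.
have Hcost k p (b : R) : (forall i, (k <= i)%N -> (cost T j (z i) (w i) <= b%:E)%E) ->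
    midhull gen k p -> (\int[lam]_(t in I) (p.2 t)%:E <= b%:E)%E.
  move=> hb; elim=> [i ki|q r hq IHq hr IHr]; first exact: hb.
  apply: integral_midpoint_le IHq IHr.
  - exact: leb_itv.
  - exact: Hmeas hq.
  - exact: Hmeas hr.
  - by move=> t; rewrite /= in_itv/=; exact: Hge0 hq t.
  - by move=> t; rewrite /= in_itv/=; exact: Hge0 hr t.
(* The defect of [p] in the equation of [y]: [e k] from replacing the state by [y] at time [t],
   [K * T * e k] from replacing it in the integrand. The defect is affine in the control, so
   midpoints inherit the bound. *)
have Hint k p t i : 0 <= t <= T -> midhull gen k p ->
    `|Int (fun s => field y s (p.1 s) i 0) t - (y t i 0 - phi 0 i 0)| <= (1 + K * T) * e k.
  move=> tI; have /andP[t0 tT'] := tI.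
  elim=> [l kl|q r hq IHq hr IHr] /=.
    have [_ _ /(_ t tI i) xI] := sxs (sg l).
    have := Int_field_dist F0L F1L UM tau0 T0 i ty (txs (sg l)) (cw l) t0
      (e := e k) (fun s _ => le_trans (eq_ind _ (fun a => a <= e l) (zy l s) _ (distrC _ _)) (ele k l kl)).
    have := le_trans (le_trans (entry_le_norm (z l t - y t) i 0) (zy l t)) (ele k l kl).
    rewrite !mxE {1}/z xI -/(w l) => h1 h2.
    have h3 : K * e k * t <= K * T * e k.
      by rewrite mulrAC ler_wpM2r ?(ltW (e0 k))// ler_wpM2l// lip_const_ge0.
    move: h1 h2 h3; set I1 := Int _ t; set I2 := Int _ t => h1 h2 h3.
    rewrite mulrDl mul1r; move: h1 h2; rewrite !ler_norml => /andP[h4 h5] /andP[h6 h7].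
    by apply/andP; split; lra.
  have cq := Hctrl _ _ hq; have cr := Hctrl _ _ hr.
  have bq := field_bmeas F0L F1L UM tau0 i tT ty cq.
  have br := field_bmeas F0L F1L UM tau0 i tT ty cr.
  have -> : Int (fun s => field y s (2^-1 *: (q.1 s + r.1 s)) i 0) t =
      2^-1 * (Int (fun s => field y s (q.1 s) i 0) t + Int (fun s => field y s (r.1 s) i 0) t).
    rewrite -IntD// -IntZ; last exact: bmeasD.
    congr (Int _ t); apply/funext => s.
    by rewrite field_midpoint !mxE.
  move: IHq IHr; rewrite !ler_norml => /andP[h1 h2] /andP[h3 h4].
  by apply/andP; split; lra.
(* By convexity of [j] in the control, the same [eps] survives every midpoint. *)
have Hj k p t eps : 0 <= t <= T ->
    (forall i, (k <= i)%N -> j t (y t) (w i t) <= j t (z i t) (w i t) + eps) ->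
    midhull gen k p -> j t (y t) (p.1 t) <= p.2 t + eps.
  move=> tI hj; elim=> [l kl|q r _ IHq _ IHr] /=; first exact: hj.
  have tI' : t \in `[0, T] by rewrite in_itv.
  have := convex_function_midpoint (q.1 t) (r.1 t) (jc (y t) tI').
  by move: IHq IHr; lra.
have [NN [mNN NN0 hNN]] := aecv.
(* On [E] all coordinates of the means converge; elsewhere the constant [u0] is used, so that
   convergence and membership in [U] hold at every time. *)
pose E := (`[0, T]%classic `\` NN) : set R.
have mE : measurable E by apply: measurableD => //; exact: measurable_itv.
have EI s : E s -> 0 <= s <= T by move=> [+ _]; rewrite /= in_itv.
have cvE s : E s -> forall l, cvgn (fun k => (v k).1 s l 0).
  move=> Es; apply: contrapT => h; case: (Es) => _; apply; apply: hNN => /= h'.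
  by apply: h; apply: h'; exact: EI.
pose u := patched E (fun s => \col_l limn (fun k => (v k).1 s l 0)) u0.
pose v' k := patched E (v k).1 u0.
have cv' k : ctrl U (v' k).
  have [mv Uv] := Hctrl _ _ (Hv' k); apply: ctrl_patched => // l.
  exact: measurable_funTS (mv l).
have v'u s : v' k s @[k --> \oo] --> u s.
  rewrite /v' /u /patched; case: asboolP => Es; last exact: cvg_cst.
  by apply: colv_cvg => l; rewrite mxE; exact: cvE.
have v'E k s : E s -> v' k s = (v k).1 s by move=> Es; rewrite /v' /patched asboolT.
have vu s : E s -> (v k).1 s @[k --> \oo] --> u s.
  by move=> Es; under eq_fun do rewrite -v'E//; exact: v'u.
have cu : ctrl U u.
  split=> [l|s]; last first.
    by apply: (closed_cvg U cU _ _ (v'u s)); apply: nearW => k; have [_] := cv' k; exact.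
  apply: (@measurable_fun_cvg _ _ _ _ (fun k s => v' k s l 0)).
    by move=> k; have [] := cv' k.
  by move=> s _; apply: cvg_colv; exact: v'u.
have aeE : {ae mu, forall s, 0 <= s <= T -> E s}.
  exists NN; split => // s /= h; apply: contrapT => nN; apply: h => sI.
  by split => //; rewrite /= in_itv.
have [B yB] := traj_bounded tT ty.
exists u, y; split => //.
  split => // t tI i; have /andP[t0 tT'] := tI.
  suff : Int (fun s => field y s (u s) i 0) t - (y t i 0 - phi 0 i 0) = 0.
    by move/eqP; rewrite subr_eq0 => /eqP ->; rewrite subrKC.
  have lim1 : Int (fun s => field y s ((v k).1 s) i 0) t @[k --> \oo] -->
      Int (fun s => field y s (u s) i 0) t.
    apply: (@Int_dominated _ _ _ (A + K * B)).
    - by move=> k; apply: (field_bmeas F0L F1L UM tau0 i tT ty); exact: Hctrl (Hv' k).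
    - exact: (field_bmeas F0L F1L UM tau0 i tT ty).
    - move=> k s; apply: le_trans (entry_le_norm _ i 0) _.
      apply: (field_bound F0L F1L UM tau0 yB _ ((Hctrl _ _ (Hv' k)).2 s)) => r _; exact: yB.
    apply: ae_imp aeE => s hE /andP[s0 st].
    have Es : E s by apply: hE; rewrite s0 (le_trans st).
    apply: cvg_colv.
    have cf : continuous (fun a : 'cV[R]_m => field y s a).
      apply: (@lip_continuous _ _ _ _ (m%:R * `|F1 (y s) (maxd tau y s)|)) => c d.
      rewrite /rhs opprD addrACA subrr add0r -mulmxBr -mulrA; exact: mulmx_norm_le.
    exact: (cvg_comp _ _ (vu s Es) (cf (u s))).
  (* One [eps] for the convergence of the integrals, the rest for the defect of [v k]. *)
  apply: (@le0_eps _ R _ (1 + (1 + K * T))) => eps eps0.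
  have /cvgrPdist_le/(_ _ eps0) lim2 := lim1.
  have [k [h1 h2]] := filter_ex (filterI lim2 (esmall _ eps0)).
  have h3 := Hint k (v k) t i tI (Hv' k).
  have h4 : (1 + K * T) * e k <= (1 + K * T) * eps.
    by rewrite ler_wpM2l ?(ltW h2)// addr_ge0// mulr_ge0// lip_const_ge0.
  rewrite (le_trans (ler_distD (Int (fun s => field y s ((v k).1 s) i 0) t) _ _))//.
  by rewrite mulrDl mul1r lerD// (le_trans h3).
rewrite /cost; apply: (@fatou_le _ _ _ lam I leb_itv (fun t => j t (y t) (u t)) (fun k t => (v k).2 t)).
- exact: (integrand_measurable jn (fun l => leb_measurable_traj l cy)
    (fun l => leb_measurable_ctrl l cu)).
- by move=> k; exact: Hmeas (Hv' k).
- by move=> t It; exact: j0.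
- by move=> k t; rewrite /= in_itv/=; exact: Hge0 (Hv' k) t.
- apply: (ae_leb _ aeE) => t hE It.
  have tI : 0 <= t <= T by move: It; rewrite /= in_itv.
  have Et := hE tI; move=> eps eps0.
  (* Half of [eps] pays for moving the state to [y t], half for lower semicontinuity at
     [(y t, u t)]. The radius [d] found next depends on [t]. *)
  have eps2 : 0 < eps / 2 by rewrite divr_gt0.
  have [d d0 hd] := near_le_compact (y t) kU (fun c w0 => @jd t c w0 It) (fun c => @jD t c It) eps2.
  have [_ /(_ t It) lsc] := jn.
  have [|V Vn hV] := lsc (y t, u t) (j t (y t) (u t) - eps / 2).
    by rewrite lte_fin ltrBlDr ltrDl.
  have cpair : (y t, (v k).1 t) @[k --> \oo] --> (y t, u t).
    have cyt : (fun=> y t) k @[k --> \oo] --> y t by exact: cvg_cst.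
    exact: (cvg_pair cyt (vu t Et)).
  have ev : \forall k \near \oo, V (y t, (v k).1 t) by exact: cpair.
  have [N1 _ hN1] := ev; have [N2 _ hN2] := esmall _ d0.
  exists (maxn N1 N2) => // k /= Nk.
  have Vk : V (y t, (v k).1 t) by apply: hN1; exact: leq_trans (leq_maxl _ _) Nk.
  have ek : e k < d by apply: hN2; exact: leq_trans (leq_maxr _ _) Nk.
  have := hV _ Vk; rewrite lte_fin /= => h1.
  have h2 : j t (y t) ((v k).1 t) <= (v k).2 t + eps / 2.
    apply: (Hj k) => // i ki; apply: hd; last by have [_] := cw i; exact.
    by apply: le_lt_trans ek; exact: le_trans (zy i t) (ele k i ki).
  by lra.
(* As [i <= sg i], every generator of a late tail has cost at most [a + eps]. *)
- move=> eps eps0; have [N0 hN0] := costa _ eps0.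
  exists N0 => k Nk; apply: Hcost (Hv' k) => i ki; apply: hN0.
  by have [isg _] := hsg i; apply: leq_trans isg; exact: leq_trans ki.
Qed.

Lemma optimal_pair : exists u x, [/\ ctrl U u, istate u x &
  forall v y, ctrl U v -> istate v y -> (cost T j x u <= cost T j y v)%E].
Proof.
have [u0 Uu0] := U0.
have c0 : ctrl U (fun=> u0) by split => // l; exact: measurable_cst.
have [x0 s0] := state_exists L0 F0L F1L M0 UM tau0 T0 cphi c0.
pose S := [set c | exists u x, [/\ ctrl U u, istate u x & cost T j x u = c]].
have S0 : S (cost T j x0 (fun=> u0)) by exists (fun=> u0), x0.
have cost0 x u : (0 <= cost T j x u)%E.
  by apply: integral_ge0 => t It; rewrite lee_fin; apply: j0.
have inf0 : (0 <= ereal_inf S)%E by apply: le_ereal_inf_tmp => _ [u [x [_ _ <-]]].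
(* With an infinite infimum every pair costs [+oo], and any one is optimal. *)
have [infy|] := eqVneq (ereal_inf S) +oo%E.
  exists (fun=> u0), x0; split => // v y cv sy.
  have : (ereal_inf S <= cost T j y v)%E by apply: ereal_inf_lbound; exists v, y.
  by rewrite infy leye_eq => /eqP ->; exact: leey.
rewrite -ltey => infy.
have fin : ereal_inf S \is a fin_num by rewrite ge0_fin_numE.
pose a := fine (ereal_inf S).
have /choice[p hp] : forall k : nat, exists p : (R -> 'cV[R]_m) * (R -> 'cV[R]_n),
    [/\ ctrl U p.1, istate p.1 p.2 & (cost T j p.2 p.1 <= (a + k.+1%:R^-1)%:E)%E].
  move=> k; have k0 : 0 < (k.+1%:R^-1 : R) by rewrite invr_gt0.
  have [_ [u [x [cu sx <-]]] /ltW h] := lb_ereal_inf_adherent k0 fin.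
  by exists (u, x); split => //; rewrite EFinD fineK.
have [| |e e0|u [x [cu sx xa]]] := @limit_pair (fun k => (p k).1) (fun k => (p k).2) a.
- by move=> k; case: (hp k).
- by move=> k; case: (hp k).
- have /cvgrPdist_lt/(_ _ e0)[N _ hN] := @cvg_harmonic R.
  exists N => k Nk; have [_ _ /le_trans] := hp k; apply.
  rewrite lee_fin lerD2l; have := hN k Nk.
  by rewrite sub0r normrN /= ger0_norm ?invr_ge0//; exact: ltW.
exists u, x; split => // v y cv sy; apply: (le_trans xa).
rewrite fineK//; apply: ereal_inf_lbound; by exists v, y.
Qed.

End control_problem.

Lemma lip2_le (R : realType) n p q (F : 'cV[R]_n -> 'cV[R]_n -> 'M[R]_(p, q)) L L' :
  L <= L' -> lip2 F L -> lip2 F L'.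
Proof.
move=> LL' FL a b a' b' e ae be; apply: le_trans (FL _ _ _ _ _ ae be) _.
by rewrite ler_wpM2r// (le_trans _ ae).
Qed.

Theorem theorem3p4 (R : realType) (n m : nat) (T tau : R)
    (F0 : 'cV[R]_n -> 'cV[R]_n -> 'cV[R]_n)
    (F1 : 'cV[R]_n -> 'cV[R]_n -> 'M[R]_(n, m))
    (phi : R -> 'cV[R]_n) (U : set 'cV[R]_m)
    (j : R -> 'cV[R]_n -> 'cV[R]_m -> R) :
  (0 < n)%N -> (0 < m)%N -> 0 < T -> 0 < tau ->
  lipschitz (fun p : 'cV[R]_n * 'cV[R]_n => F0 p.1 p.2) ->
  C1 (fun p : 'cV[R]_n * 'cV[R]_n => F0 p.1 p.2) ->
  lipschitz (fun p : 'cV[R]_n * 'cV[R]_n => F1 p.1 p.2) ->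
  C1 (fun p : 'cV[R]_n * 'cV[R]_n => F1 p.1 p.2) ->
  {within [set` `[- tau, 0]], continuous phi} ->
  U !=set0 -> convex_set U -> compact U ->
  normal_integrand T j ->
  (forall t x u, t \in `[0, T] -> 0 <= j t x u) ->
  (forall t x, t \in `[0, T] -> convex_function setT (fun u => j t x u)) ->
  (forall t x u, t \in `[0, T] -> differentiable (fun y => j t y u) x) ->
  (forall t (v : 'cV[R]_n), t \in `[0, T] ->
     continuous (fun p : 'cV[R]_n * 'cV[R]_m => 'D_v (fun y => j t y p.2) p.1)) ->
  exists (ustar : R -> 'cV[R]_m) (xstar : R -> 'cV[R]_n),
    [/\ feasible T U ustar,
        assoc_state T tau F0 F1 phi ustar xstar &
        forall (u : R -> 'cV[R]_m) (x : R -> 'cV[R]_n),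
          feasible T U u -> assoc_state T tau F0 F1 phi u x ->
          (cost T j xstar ustar <= cost T j x u)%E].
Proof.
move=> n0 m0 T0 tau0 lF0 CF0 lF1 CF1 cphi U0 cvU kU jn j0 jc jd jD.
have [L0 L0_ge0 F0L0] := lipschitz_lip2 lF0.
have [L1 L1_ge0 F1L1] := lipschitz_lip2 lF1.
have L_ge0 : 0 <= L0 + L1 by exact: addr_ge0.
have F0L : lip2 F0 (L0 + L1) by apply: lip2_le F0L0; rewrite lerDl.
have F1L : lip2 F1 (L0 + L1) by apply: lip2_le F1L1; rewrite lerDr.
have [M [_ hM]] := compact_bounded kU.
have UM w : U w -> `|w| <= M + 1 by move=> Uw; apply: (hM (M + 1)) => //; rewrite ltrDl.
have M_ge0 : 0 <= M + 1 by have [w /UM] := U0; exact: le_trans.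
have cU : closed U by apply: compact_closed kU; exact: norm_hausdorff.
have [T_ge0 tau_ge0] := (ltW T0, ltW tau0).
have [u [x [cu sx opt]]] := optimal_pair L_ge0 F0L F1L M_ge0 UM tau_ge0 T_ge0
  cphi cU U0 cvU jn j0 jc jd jD kU.
exists u, x; split.
- exact: feasible_ctrl UM _ cu.
- exact: istate_assoc L_ge0 F0L F1L M_ge0 UM tau_ge0 T_ge0 _ _ cu sx.
(* A competitor is traded for a Borel modification of its control and the constant extension of its
   state, at equal cost. *)
move=> v y fv sy; have [w cw vw] := ctrl_of_feasible U0 fv.
have sz := assoc_istate F0L F1L UM tau_ge0 T_ge0 cw vw sy.
have [[cz _] _ _] := sz.
rewrite (cost_eq UM jn j0 (z := y \o clamp (- tau) T) fv.1.1 cw cz _ vw); first exact: opt.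
move=> s /andP[s0 sT]; rewrite /= clamp_id// sT andbT.
by apply: le_trans s0; rewrite oppr_le0.
Qed.
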